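(* Let $\mathbf e=(e_1,\dots,e_m)\in\mathbb Z^m$ with $\gcd(e_1,\dots,e_m,r)=1$, let $L=\{\mathbf u\in\mathbb Z^m:\mathbf e\cdot\mathbf u\in r\mathbb Z\}$, let $\underline{\mathbf w}=(\mathbf w_1,\dots,\mathbf w_m)$ be a $\mathbb Z$-basis of $L$, and let $c$ be an integer with $0\le c\le q-2$. Then the dimension $k$ (over $\mathbb F_{q^r}$) and the minimum sum-rank distance $d$ of the code $\mathrm{LRM}(\mathbf e;\,cS_{\underline{\mathbf w}})$ satisfy $$k=\operatorname{Card}\big(cS_{\underline{\mathbf w}}\cap\mathbb Z^m\big)=P_{\underline{\mathbf w}}(c)\qquad\text{and}\qquad d\ \ge\ r\,(q-1)^{m-1}\,(q-1-c).$$
   Context: $\mathbb F_q$ is a finite field with $q$ elements, $\mathbb F_{q^r}$ its extension of degree $r\ge 1$, $\Phi:\mathbb F_{q^r}\to\mathbb F_{q^r}$, $x\mapsto x^q$, and $m\ge1$. The ring $\mathbb F_{q^r}[\mathbf X^{\pm1};\boldsymbol\theta]$ of multivariate Ore Laurent polynomials consists of finite sums $\sum_{\mathbf u\in\mathbb Z^m}a_{\mathbf u}\mathbf X^{\mathbf u}$ ($a_{\mathbf u}\in\mathbb F_{q^r}$, $\mathbf X^{\mathbf u}=X_1^{u_1}\cdots X_m^{u_m}$), where the variables commute with each other and $\mathbf X^{\mathbf u}\cdot a=\Phi^{\mathbf e\cdot\mathbf u}(a)\,\mathbf X^{\mathbf u}$ for $a\in\mathbb F_{q^r}$, with $\mathbf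 e\cdot\mathbf u=\sum_i e_iu_i$. Let $H$ be the set of group homomorphisms $\gamma:L\to\mathbb F_q^\times$. For every $\gamma\in H$ fix a function $\tilde\gamma:\mathbb Z^m\to\mathbb F_{q^r}^\times$ extending $\gamma$ and satisfying the cocycle condition $\tilde\gamma(\mathbf u+\mathbf v)=\tilde\gamma(\mathbf u)\cdot\Phi^{\mathbf e\cdot\mathbf u}(\tilde\gamma(\mathbf v))$ for all $\mathbf u,\mathbf v\in\mathbb Z^m$ (such extensions exist). This gives a ring homomorphism $\epsilon_{\tilde\gamma}:\mathbb F_{q^r}[\mathbf X^{\pm1};\boldsymbol\theta]\to\operatorname{End}_{\mathbb F_q}(\mathbb F_{q^r})$, $\sum a_{\mathbf u}\mathbf X^{\mathbf u}\mapsto\sum a_{\mathbf u}\tilde\gamma(\mathbf u)\Phi^{\mathbf e\cdot\mathbf u}$. Put $\epsilon=(\epsilon_{\tilde\gamma})_{\gamma\in H}$, with values in $\mathcal H=\prod_{\gamma\in H}\operatorname{End}_{\mathbb F_q}(\mathbb F_{q^r})$; $\mathcal H$ is an $\mathbb F_{q^r}$-vector space via $(a\varphi)(x)=a\cdot\varphi(x)$. For a compact convex $C\subset\mathbb R^m$, $\mathrm{LRM}(\mathbf e;C)=\epsilon\big(\mathbb F_{q^r}[\mathbf X^{\pm1};\boldsymbol\theta]_C\big)$, where $\mathbb F_{q^r}[\mathbf X^{\pm1};\boldsymbol\theta]_C$ is the $\mathbb F_{q^r}$-span of the monomials $\mathbf X^{\mathbf u}$ with $\mathbf u\in C\cap\mathbb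 Z^m$. The dilated simplex is $$cS_{\underline{\mathbf w}}=\Big\{\lambda_1\mathbf w_1+\cdots+\lambda_m\mathbf w_m:\ \lambda_i\in\mathbb R_{\ge0},\ \lambda_1+\cdots+\lambda_m\le c\Big\}.$$ $P_{\underline{\mathbf w}}$ is the Ehrhart polynomial of $S_{\underline{\mathbf w}}$, i.e. the polynomial with $P_{\underline{\mathbf w}}(t)=\operatorname{Card}(tS_{\underline{\mathbf w}}\cap\mathbb Z^m)$ for all integers $t\ge0$ (it exists by Ehrhart's theorem). The sum-rank weight of $(\varphi_\gamma)_{\gamma\in H}\in\mathcal H$ is $\sum_\gamma\operatorname{rank}_{\mathbb F_q}(\varphi_\gamma)$, and the minimum distance of a code is the minimum sum-rank weight of its nonzero elements. *)

(* Defs.v *)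
From HB Require Import structures.
From mathcomp Require Import all_boot all_order all_algebra all_fingroup.
From mathcomp Require Import all_solvable all_field finmap.
From mathcomp Require Import boolp classical_sets cardinality reals.
From mathcomp Require Import monalg.

Set Implicit Arguments.
Unset Strict Implicit.
Unset Printing Implicit Defensive.

Import Order.TTheory GRing.Theory Num.Theory.
(* makes 'End(E) a unit ring, so that f ^ n makes sense for n : int *)
Import FalgLfun.
Local Open Scope ring_scope.

(* Throughout, F is F_q with q = #|F|, and E is F_{q^r} with r = \dim {:E}.   *)

Section Frobenius.
Variables (F : finFieldType) (E : fieldExtType F).

Definition frob_fun (x : E) : E := x ^+ #|F|.

Lemma frob_fun_linear : linear frob_fun.
Proof.
have [p p_pr chF] := finPcharP F.
have chE : p \in [pchar E] by rewrite (pchar_lalg E).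
have q_nat : [pchar E].-nat #|F|.
  rewrite (eq_pnat _ (pcharf_eq chE)) -cardsT.
  have /is_abelemP[p' p'_pr abF] := @finField_is_abelem F.
  have pF : (p'.-group [set: F])%g := abelem_pgroup abF.
  suff -> : p = p' by [].
  have := abelem_order_p abF (finset.in_setT (1 : F)) (oner_neq0 F).
  move=> o1; have : p'%:R = 0 :> F.
    by rewrite -o1 -FinRing.zmodXgE; apply: expg_order.
  move/eqP; rewrite -(dvdn_pcharf chF) => /prime_nt_dvdP -> //.
  by rewrite gtn_eqF // prime_gt1.
move=> a u v; rewrite /frob_fun exprDn_pchar // exprZn.
by rewrite expf_card.
Qed.

HB.instance Definition _ := GRing.isLinear.Build F E E *:%R frob_fun
  frob_fun_linear.

Definition frob : 'End(E) := linfun frob_fun.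

Lemma frobE x : frob x = x ^+ #|F|.
Proof. by rewrite lfunE. Qed.

Lemma frob_unit : frob \is a GRing.unit.
Proof.
suff k0 : lker frob == 0%VS.
  by apply/unitrP; exists (frob^-1)%VF; rewrite lfun_mulVr ?lfun_mulrV.
apply/lker0P => x y; rewrite !frobE => exy; apply/eqP; rewrite -subr_eq0.
have : frob (x - y) == 0 by rewrite linearB /= !frobE exy subrr.
by rewrite frobE expf_eq0 => /andP[].
Qed.

Definition frobz (n : int) : 'End(E) := frob ^ n.

Lemma frobz0 x : frobz 0 x = x.
Proof. by rewrite /frobz expr0z lfunE. Qed.

Lemma frobzD n k x : frobz (n + k) x = frobz n (frobz k x).
Proof. by rewrite /frobz addrC exprzDr ?frob_unit // lfun_mulE. Qed.

Lemma frobzM n x y : frobz n (x * y) = frobz n x * frobz n y.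
Proof.
have posM (k : nat) a b : frobz k (a * b) = frobz k a * frobz k b.
  elim: k a b => [|k IHk] a b; first by rewrite !frobz0.
  have frob1 c : frobz k.+1 c = frobz k (frob c).
    by rewrite -addn1 PoszD frobzD.
  by rewrite !frob1 !frobE exprMn IHk.
case: n => [k|k]; first exact: posM.
have frobK c : frobz k.+1 (frobz (Negz k) c) = c.
  by rewrite -frobzD NegzE subrr frobz0.
have frobV c : frobz (Negz k) (frobz k.+1 c) = c.
  by rewrite -frobzD NegzE addNr frobz0.
by rewrite -{1}(frobK x) -{1}(frobK y) -posM frobV.
Qed.

Lemma frobz1 n : frobz n 1 = 1.
Proof.
have f1_neq0 : frobz n 1 != 0.
  apply/eqP => f1; have : frobz (- n) (frobz n 1) = 1.
    by rewrite -frobzD addNr frobz0.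
  by rewrite f1 linear0 => /esym/eqP; rewrite oner_eq0.
by apply: (mulfI f1_neq0); rewrite -frobzM !mulr1.
Qed.

End Frobenius.

Section MalgSum.
Variables (K : choiceType) (G V : zmodType) (h : K -> G -> V).
Hypothesis hD : forall k, {morph h k : a b / a + b}.

Definition msum (f : {malg G[K]}) : V := \sum_(k <- msupp f) h k f@_k.

Let h0 k : h k 0 = 0.
Proof. by apply: (addrI (h k 0)); rewrite -hD !addr0. Qed.

Lemma msumEw (D : {fset K}) f : (msupp f `<=` D)%fset ->
  msum f = \sum_(k <- D) h k f@_k.
Proof.
by move=> fD; apply: big_fset_incl => // k _ kf; rewrite mcoeff_outdom // h0.
Qed.

Lemma msumD : {morph msum : f g / f + g}.
Proof.
move=> f g; rewrite (msumEw (msuppD_le f g)).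
rewrite (msumEw (fsubsetUl (msupp f) (msupp g))).
rewrite (msumEw (fsubsetUr (msupp f) (msupp g))) -big_split /=.
by apply: eq_bigr => k _; rewrite mcoeffD hD.
Qed.

Lemma msum0 : msum 0 = 0.
Proof. by rewrite /msum msupp0 big_seq_fset0. Qed.

Lemma msumU k a : msum << a *g k >> = h k a.
Proof. by rewrite (msumEw msuppU_le) big_seq_fset1 mcoeffUU. Qed.

Lemma malg_ind (P : {malg G[K]} -> Prop) : P 0 ->
  (forall f g, P f -> P g -> P (f + g)) -> (forall k a, P << a *g k >>) ->
  forall f, P f.
Proof. by move=> P0 PD PU f; rewrite [f]monalgE; elim/big_ind: _. Qed.

End MalgSum.

Section SpannedMul.
Variables (V : zmodType) (mul : V -> V -> V).
Hypotheses (mulDl : left_distributive mul +%R).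
Hypotheses (mulDr : right_distributive mul +%R).

Definition spanned (S : V -> Prop) := forall P : V -> Prop, P 0 ->
  (forall f g, P f -> P g -> P (f + g)) -> (forall f, S f -> P f) ->
  forall f, P f.

Variable S : V -> Prop.
Hypothesis spanS : spanned S.

Let mul0l f : mul 0 f = 0.
Proof. by apply: (addrI (mul 0 f)); rewrite -mulDl !addr0. Qed.

Let mul0r f : mul f 0 = 0.
Proof. by apply: (addrI (mul f 0)); rewrite -mulDr !addr0. Qed.

Lemma spanned_mulA :
  (forall f g h, S f -> S g -> S h -> mul f (mul g h) = mul (mul f g) h) ->
  associative mul.
Proof.
move=> SA f g h; elim/spanS: f => [|f f' IHf IHf'|f Sf].
- by rewrite !mul0l.
- by rewrite !mulDl IHf IHf'.
elim/spanS: g => [|g g' IHg IHg'|g Sg].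
- by rewrite mul0l !mul0r mul0l.
- by rewrite !(mulDl, mulDr) IHg IHg'.
elim/spanS: h => [|h h' IHh IHh'|h Sh].
- by rewrite !mul0r.
- by rewrite !mulDr IHh IHh'.
exact: SA.
Qed.

Lemma spanned_mul1l i : (forall f, S f -> mul i f = f) -> left_id i mul.
Proof.
move=> Si; elim/spanS => [|f g IHf IHg|f /Si//]; first by rewrite mul0r.
by rewrite mulDr IHf IHg.
Qed.

Lemma spanned_mul1r i : (forall f, S f -> mul f i = f) -> right_id i mul.
Proof.
move=> Si; elim/spanS => [|f g IHf IHg|f /Si//]; first by rewrite mul0l.
by rewrite mulDl IHf IHg.
Qed.

End SpannedMul.

Section OreRing.
Variables (F : finFieldType) (E : fieldExtType F) (m : nat).

Definition dotz (e u : 'rV[int]_m) : int := \sum_i e 0 i * u 0 i.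

Lemma dotzDr e u v : dotz e (u + v) = dotz e u + dotz e v.
Proof.
by rewrite /dotz -big_split; apply: eq_bigr => i _; rewrite mxE mulrDr.
Qed.

Lemma dotzNr e u : dotz e (- u) = - dotz e u.
Proof.
by rewrite /dotz -sumrN; apply: eq_bigr => i _; rewrite mxE mulrN.
Qed.

Lemma dotz0r e : dotz e 0 = 0.
Proof. by apply: big1 => i _; rewrite mxE mulr0. Qed.

(* F_{q^r}[X^{+-1}; theta]: << a *g u >> is the monomial a X^u, f@_u is the
   coefficient of X^u, and the phantom e determines the product.              *)
Definition ore (e : 'rV[int]_m) : Type := {malg E['rV[int]_m]}.

Variable e : 'rV[int]_m.
Local Notation oreE := (ore e).

HB.instance Definition _ := GRing.Lmodule.copy oreE {malg E['rV[int]_m]}.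

Implicit Types f g : oreE.

Lemma ore_ind (P : oreE -> Prop) : P 0 ->
  (forall f g, P f -> P g -> P (f + g)) -> (forall u a, P << a *g u >>) ->
  forall f, P f.
Proof. exact: malg_ind. Qed.

Definition ore1 : oreE := << 1 *g 0 >>.

Definition oremul f g : oreE :=
  \sum_(u <- msupp f) \sum_(v <- msupp g)
     << f@_u * frobz E (dotz e u) g@_v *g u + v >>.

Let mulU (u : 'rV[int]_m) (a : E) (v : 'rV[int]_m) (b : E) : oreE :=
  << a * frobz E (dotz e u) b *g u + v >>.

Let mulUD u a v : {morph mulU u a v : b c / b + c}.
Proof. by move=> b c; rewrite /mulU linearD mulrDr monalgUD. Qed.

Let mulmU g u : {morph (fun a => msum (mulU u a) g) : a b / a + b}.
Proof.
move=> a b; rewrite /msum -big_split; apply: eq_bigr => v _.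
by rewrite /mulU mulrDl monalgUD.
Qed.

Let oremulE f g : oremul f g = msum (fun u a => msum (mulU u a) g) f.
Proof. by []. Qed.

Fact oremulDl : left_distributive oremul +%R.
Proof. by move=> f g h; rewrite !oremulE (msumD (mulmU h)). Qed.

Fact oremulDr : right_distributive oremul +%R.
Proof.
move=> h f g; rewrite !oremulE /msum -big_split; apply: eq_bigr => u _.
exact: (msumD (mulUD u h@_u)).
Qed.

Lemma oremulUU u a v b : oremul << a *g u >> << b *g v >> =
  << a * frobz E (dotz e u) b *g u + v >>.
Proof. by rewrite oremulE (msumU (mulmU _)) (msumU (mulUD _ _)). Qed.

Let oremul0l f : oremul 0 f = 0.
Proof. exact: (msum0 (fun u a => msum (mulU u a) f)). Qed.

Let oremul0r f : oremul f 0 = 0.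
Proof. by rewrite oremulE /msum big1 // => u _; apply: (msum0 (mulU u f@_u)). Qed.

Let ore_spanned : spanned (fun f : oreE => exists u a, f = << a *g u >>).
Proof. by move=> P P0 PD PU; apply: ore_ind => // u a; apply: PU; exists u, a. Qed.

Fact oremulA : associative oremul.
Proof.
apply: (spanned_mulA oremulDl oremulDr ore_spanned).
move=> _ _ _ [u [a ->]] [v [b ->]] [w [c ->]].
transitivity (oremul << a *g u >> << b * frobz E (dotz e v) c *g v + w >>).
  by congr (oremul _ _); apply: oremulUU.
transitivity (oremul << a * frobz E (dotz e u) b *g u + v >> << c *g w >>).
  by rewrite [LHS]oremulUU [RHS]oremulUU frobzM dotzDr frobzD mulrA addrA.
by congr (oremul _ _); symmetry; apply: oremulUU.
Qed.

Fact oremul1l : left_id ore1 oremul.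
Proof.
apply: (spanned_mul1l oremulDr ore_spanned) => _ [u [a ->]].
by rewrite oremulUU dotz0r frobz0 mul1r add0r.
Qed.

Fact oremul1r : right_id ore1 oremul.
Proof.
apply: (spanned_mul1r oremulDl ore_spanned) => _ [u [a ->]].
by rewrite oremulUU frobz1 mulr1 addr0.
Qed.

Fact ore1_neq0 : ore1 != 0.
Proof. by rewrite monalgU_eq0 oner_eq0. Qed.

HB.instance Definition _ := GRing.Zmodule_isNzRing.Build oreE
  oremulA oremul1l oremul1r oremulDl oremulDr ore1_neq0.

End OreRing.

Section Lattice.
Variables (r m : nat) (e : 'rV[int]_m).

Definition lattice : {pred 'rV[int]_m} := [pred u | (r %| dotz e u)%Z].

Fact lattice_zmod_closed : zmod_closed lattice.
Proof.
split=> [|u v]; rewrite !inE ?dotz0r ?dvdz0 //.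
by move=> ru rv; rewrite dotzDr dotzNr rpredB.
Qed.

HB.instance Definition _ := GRing.isZmodClosed.Build _ lattice
  lattice_zmod_closed.

Record lat := Lat { lat_val :> 'rV[int]_m; lat_valP : lat_val \in lattice }.

HB.instance Definition _ := [isSub for lat_val].
HB.instance Definition _ := [Choice of lat by <:].
HB.instance Definition _ := [SubChoice_isSubZmodule of lat by <:].

Lemma lat_valD (u v : lat) : lat_val (u + v) = lat_val u + lat_val v.
Proof. exact: (raddfD (val : lat -> _)). Qed.

Lemma lat_valB (u v : lat) : lat_val (u - v) = lat_val u - lat_val v.
Proof. exact: (raddfB (val : lat -> _)). Qed.

Lemma lat_valMn (u : lat) n : lat_val (u *+ n) = lat_val u *+ n.
Proof. exact: (raddfMn (val : lat -> _)). Qed.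

(* (w_1, ..., w_m) is a Z-basis of L *)
Definition lattice_basis (w : 'I_m -> 'rV[int]_m) : Prop :=
  (forall i, w i \in lattice) /\
  (forall u, u \in lattice ->
     exists! a : 'I_m -> int, u = \sum_i a i *: w i).

End Lattice.

Section Characters.
Variables (F : finFieldType) (E : fieldExtType F) (m : nat).
Variable e : 'rV[int]_m.

(* the set H of the group homomorphisms from L to the units of F *)
Record latchar := LatChar {
  latchar_val :> lat (\dim {:E}) e -> {unit F};
  latcharD : forall u v,
    latchar_val (u + v) = (latchar_val u * latchar_val v)%g }.

Lemma latchar_inj (g h : latchar) : g =1 h -> g = h.
Proof.
case: g h => [g gD] [h hD] /= /funext gh; rewrite {}gh in gD *.
by congr LatChar; apply: Prop_irrelevance.
Qed.

(* H is finite: with n the order of the units of F, a character is trivial on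
   the n-th multiples, hence is determined by its values on the u in L all of
   whose coordinates satisfy 0 <= u_i < n r.                                  *)
Let n := #|{: {unit F}}|.
Let N := (n * \dim {:E})%N.

Let box (t : {ffun 'I_m -> 'I_N}) : 'rV[int]_m := \row_i (t i : nat)%:Z.

Let code (g : latchar) : {ffun {ffun 'I_m -> 'I_N} -> {unit F}} :=
  [ffun t => g (insubd 0 (box t))].

Lemma latchar0 (g : latchar) : g 0 = 1%g.
Proof. by apply: (mulgI (g 0)); rewrite -latcharD addr0 mulg1. Qed.

Lemma latcharMn (g : latchar) u k : g (u *+ k) = (g u ^+ k)%g.
Proof.
elim: k => [|k IHk]; first by rewrite mulr0n latchar0.
by rewrite mulrS latcharD IHk expgS.
Qed.

Let latcharX (g : latchar) u : g (u *+ n) = 1%g.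
Proof. by rewrite latcharMn /n -cardsT expg_cardG ?finset.in_setT. Qed.

Let code_inj : injective code.
Proof.
have r_gt0 : (0 < \dim {:E})%N by rewrite adim_gt0.
have n_gt0 : (0 < n)%N by apply/card_gt0P; exists 1%g.
have N_gt0 : (0 < N)%N by rewrite muln_gt0 n_gt0.
move=> g h /ffunP gh; apply: latchar_inj => u.
pose x i : int := lat_val u 0 i.
have modN i : (`|modz (x i) N| < N)%N.
  by rewrite -ltz_nat gez0_abs ?modz_ge0 ?ltz_pmod // gt_eqF.
pose t : {ffun 'I_m -> 'I_N} := [ffun i => Ordinal (modN i)].
pose v : 'rV[int]_m := \row_i (divz (x i) N *+ \dim {:E}).
have vL : v \in lattice (\dim {:E}) e.
  rewrite inE /dotz; elim/big_ind: _ => [|a b ra rb|i _]; first exact: dvdz0.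
    exact: rpredD.
  by rewrite mxE -mulr_natr mulrA natz dvdz_mull.
have uE : box t = lat_val u - lat_val (Lat vL) *+ n.
  apply/rowP => i; rewrite !mxE ffunE /= mulmxnE mxE.
  rewrite gez0_abs ?modz_ge0 ?gt_eqF // /modz -mulrnA mulnC.
  by rewrite -mulr_natr natz.
have tL : insubd 0 (box t) = u - Lat vL *+ n.
  by rewrite uE -lat_valMn -lat_valB; apply: (valKd 0 (u - Lat vL *+ n)).
have uD : u = insubd 0 (box t) + Lat vL *+ n by rewrite tL subrK.
have := gh t; rewrite !ffunE => ght.
by rewrite uD !latcharD !latcharX ght.
Qed.

Let decode (c : {ffun {ffun 'I_m -> 'I_N} -> {unit F}}) : option latchar :=
  if pselect (exists g, code g = c) is left cP then Some (projT1 (cid cP))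
  else None.

Let codeK : pcancel code decode.
Proof.
move=> g; rewrite /decode; case: pselect => [cP|[]]; last by exists g.
by congr Some; apply: code_inj; apply: projT2 (cid cP).
Qed.

HB.instance Definition _ := Equality.copy latchar (pcan_type codeK).
HB.instance Definition _ := Choice.copy latchar (pcan_type codeK).
HB.instance Definition _ := Countable.copy latchar (pcan_type codeK).
HB.instance Definition _ : isFinite latchar := PCanIsFinite codeK.

End Characters.

Section EndE.
Variables (F : finFieldType) (E : fieldExtType F).

(* End_{F_q}(F_{q^r}), as a vector space over F_{q^r} *)
Definition endE : Type := 'End(E).
HB.instance Definition _ := GRing.Zmodule.copy endE 'End(E).

Implicit Types (a b : E) (phi psi : endE).

Definition endE_scale a phi : endE := (amull a \o phi)%VF.

Lemma endE_scaleE a phi x : (endE_scale a phi : 'End(E)) x = a * phi x.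
Proof. by rewrite /endE_scale comp_lfunE lfunE. Qed.

Fact endE_scaleA a b phi :
  endE_scale a (endE_scale b phi) = endE_scale (a * b) phi.
Proof. by apply/lfunP => x; rewrite !endE_scaleE mulrA. Qed.

Fact endE_scale1 : left_id 1 endE_scale.
Proof. by move=> phi; apply/lfunP => x; rewrite endE_scaleE mul1r. Qed.

Fact endE_scaleDr : right_distributive endE_scale +%R.
Proof.
move=> a phi psi; apply/lfunP => x.
by rewrite endE_scaleE !add_lfunE !endE_scaleE mulrDr.
Qed.

Fact endE_scaleDl phi : {morph endE_scale^~ phi : a b / a + b}.
Proof.
move=> a b; apply/lfunP => x.
by rewrite add_lfunE !endE_scaleE mulrDl.
Qed.

HB.instance Definition _ := GRing.Zmodule_isLmodule.Build E endE
  endE_scaleA endE_scale1 endE_scaleDr endE_scaleDl.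

Let b_ i : E := (vbasis {:E})`_i.

Fact endE_vect_axiom : Vector.axiom (\dim {:E}) endE.
Proof.
pose v2r phi : 'rV[E]_(\dim {:E}) := \row_i (phi : 'End(E)) (b_ i).
pose r2v_fun (v : 'rV[E]_(\dim {:E})) x : E :=
  \sum_i coord (vbasis {:E}) i x *: v 0 i.
have r2v_lin v : linear (r2v_fun v).
  move=> k x y; rewrite /r2v_fun scaler_sumr -big_split.
  by apply: eq_bigr => i _; rewrite linearP scalerDl scalerA.
pose r2v v : endE := linfun (HB.pack (r2v_fun v)
  (GRing.isLinear.Build F E E *:%R (r2v_fun v) (r2v_lin v)) : {linear E -> E}).
have r2vE v x : (r2v v : 'End(E)) x = r2v_fun v x by rewrite lfunE.
exists v2r => [a phi psi|].
  by apply/rowP => i; rewrite !mxE add_lfunE endE_scaleE.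
exists r2v => [phi|v].
  apply/lfunP => x; rewrite r2vE.
  rewrite [in RHS](coord_vbasis (memvf x)) linear_sum /=.
  by apply: eq_bigr => i _; rewrite mxE linearZ.
apply/rowP => i; rewrite mxE r2vE /r2v_fun (bigD1 i) //=.
rewrite coord_free ?(basis_free (vbasisP _)) // eqxx scale1r.
rewrite big1 ?addr0 // => j /negPf ji.
by rewrite coord_free ?(basis_free (vbasisP _)) // eq_sym ji scale0r.
Qed.

HB.instance Definition _ := Lmodule_hasFinDim.Build E endE endE_vect_axiom.

End EndE.

Local Open Scope classical_set_scope.

Section Code.
Variables (R : realType) (F : finFieldType) (E : fieldExtType F) (m : nat).
Variable e : 'rV[int]_m.

(* t : Z^m -> F_{q^r}^* is a cocycle that extends the character g *)
Definition cocycle_extension (g : latchar E e) (t : 'rV[int]_m -> E) : Prop :=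
  [/\ forall u, t u != 0,
      forall u : lat (\dim {:E}) e, t u = (FinRing.uval (g u))%:A &
      forall u v, t (u + v) = t u * frobz E (dotz e u) (t v)].

Definition eps_at (t : 'rV[int]_m -> E) (f : ore E e) : endE E :=
  \sum_(u <- msupp f) (f@_u * t u) *: (frobz E (dotz e u) : endE E).

Local Notation sum_rank_space := {ffun latchar E e -> endE E}.

Implicit Types (t : latchar E e -> 'rV[int]_m -> E) (phi : sum_rank_space).

Definition eps t (f : ore E e) : sum_rank_space :=
  [ffun g => eps_at (t g) f].

Definition lattice_points (C : set 'rV[R]_m) : set 'rV[int]_m :=
  [set u | C (map_mx intr u)].

(* the span of the monomials X^u for u in the intersection of C with Z^m *)
Definition ore_supported (C : set 'rV[R]_m) : set (ore E e) :=
  [set f | {subset msupp f <= lattice_points C}].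

Definition LRM t (C : set 'rV[R]_m) : set sum_rank_space :=
  [set eps t f | f in ore_supported C].

Definition sum_rank_weight phi : nat :=
  (\sum_g \dim (limg (phi g : 'End(E))))%N.

(* C is an F_{q^r}-linear subspace, of dimension k over F_{q^r} *)
Definition has_dimension (C : set sum_rank_space) (k : nat) : Prop :=
  exists2 V : {vspace sum_rank_space}, C = [set` V] & \dim V = k.

Definition is_min_distance (C : set sum_rank_space) (d : nat) : Prop :=
  (exists phi, [/\ C phi, phi != 0 & sum_rank_weight phi = d]) /\
  (forall phi, C phi -> phi != 0 -> (d <= sum_rank_weight phi)%N).

End Code.

Section Ehrhart.
Variables (R : realType) (m : nat) (w : 'I_m -> 'rV[int]_m).

(* c S_w *)
Definition simplex (c : R) : set 'rV[R]_m :=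
  [set x | exists lam : 'I_m -> R,
     [/\ forall i, 0 <= lam i, \sum_i lam i <= c &
         x = \sum_i lam i *: map_mx intr (w i)]].

(* meaningful only when C contains finitely many integral points, as does
   every bounded set (fset_set is empty on infinite sets)                     *)
Definition lattice_card (C : set 'rV[R]_m) : nat :=
  #|` fset_set (lattice_points C)|.

(* The quantifier over t determines P; its existence is Ehrhart's theorem, and
   the default value 0 of xget is not used.                                   *)
Definition ehrhart : {poly rat} :=
  xget 0 [set P | forall t : nat, P.[t%:R] = (lattice_card (simplex t%:R))%:R].

End Ehrhart.

(* Main.v *)
(* Let W have the w_i as rows. For u in Z^m put beta(u) = r u W^-1; then u lies
   in c S_w iff beta(u) >= 0 and the sum of the beta_i(u) is at most r c. The
   image of X^u in the product of the End(F_{q^r}) only depends on beta(u)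
   modulo r(q-1), and by a Dedekind argument these images are linearly
   independent over F_{q^r} when beta(u) runs over the box [0, r(q-1))^m. As
   c < q-1, this gives k.

   The sum-rank weight of phi is the dimension over F_{q^r} of the left ideal
   generated by phi. If phi is the image of f, with leading exponent u0, the
   X^v f such that beta(v) >= 0 and v + u0 lies in the box have distinct
   leading exponents v + u0, also after reduction into the box, because
   reduction lowers the exponents. So the weight is at least the number of
   points u of the box with beta(u) >= beta(u0). The box has r(q-1)^m points,
   at most beta_i(u0)(q-1)^(m-1) of which satisfy beta_i(u) < beta_i(u0), and
   the sum of the beta_i(u0) is at most r c.

   The points of c S_w split according to their class modulo L; each class
   contributes a number of points binomial(c + m - j, m) with 0 <= j <= m,
   which is polynomial in c.                                                  *)
From HB Require Import structures.
Require Import Defs.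
From mathcomp Require Import all_boot all_order all_algebra all_fingroup.
From mathcomp Require Import all_solvable all_field finmap.
From mathcomp Require Import boolp classical_sets cardinality reals.
From mathcomp Require Import monalg.
From mathcomp Require Import zify ring.

Set Implicit Arguments.
Unset Strict Implicit.
Unset Printing Implicit Defensive.

Import Order.TTheory GRing.Theory Num.Theory.
Local Open Scope ring_scope.

(** * Integer powers of the Frobenius on F_{q^r} *)

Section FrobeniusPowers.
Variables (F : finFieldType) (E : fieldExtType F).

Lemma card_fieldExt : #|finvect_type E| = (#|F| ^ \dim {:E})%N.
Proof.
pose cE : Vector F (finvect_type E) := Vector.class (finvect_type E).
by rewrite -(card_vspacef cE) card_vspace.
Qed.

Lemma frobz_scalar n (k : F) : frobz E n k%:A = k%:A.
Proof. by rewrite linearZ /= frobz1. Qed.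

Lemma frobz_nat (n : nat) (x : E) : frobz E n x = x ^+ (#|F| ^ n).
Proof.
elim: n => [|n IHn] in x *; first by rewrite frobz0 expr1.
rewrite -addn1 PoszD frobzD /frobz expr1z frobE -/(frobz E n) IHn.
by rewrite -exprM -expnS addn1.
Qed.

Lemma frobz_dim (k : int) (x : E) : frobz E ((\dim {:E})%:Z * k) x = x.
Proof.
have frob1 (y : E) : frobz E (\dim {:E})%:Z y = y.
  by rewrite frobz_nat -card_fieldExt (expf_card (y : finvect_type E)).
elim/int_ind: k => [|k IHk|k IHk]; first by rewrite mulr0 frobz0.
  by rewrite intS mulrDr mulr1 frobzD IHk frob1.
by rewrite -{1}(frob1 x) -frobzD intS opprD mulrDr mulrN1 addrAC addNr add0r.
Qed.

Lemma frobz_neq0 (k : int) (x : E) : x != 0 -> frobz E k x != 0.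
Proof.
apply: contraNneq => fx; rewrite -(frobz0 x) -(addNr k) frobzD fx.
by rewrite linear0.
Qed.

(** Only j = s mod r matters, and for 0 < j < r the polynomial X^(q^j) - X has at most q^j < q^r
    roots. *)
Lemma frobz_moves (s : int) : ~~ ((\dim {:E})%:Z %| s)%Z ->
  exists y : E, frobz E s y != y.
Proof.
set r := \dim {:E} => rs; have r_gt0 : (0 < r)%N by apply: adim_gt0.
have [j sE jr] : exists2 j : nat, (s %% r)%Z = j & (0 < j < r)%N.
  exists `|(s %% r)%Z|%N; first by rewrite gez0_abs ?modz_ge0 // gt_eqF.
  apply/andP; split.
    by rewrite absz_gt0; apply: contra rs => /eqP/dvdz_mod0P.
  by rewrite -ltz_nat gez0_abs ?modz_ge0 ?ltz_pmod // gt_eqF.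
have /andP[j_gt0 jr'] := jr.
have q_gt1 : (1 < #|F|)%N := finNzRing_gt1 F.
apply: contrapT => fixs.
have fixj (y : E) : y ^+ (#|F| ^ j) = y.
  rewrite -frobz_nat -sE; apply: contrapT => /eqP ny; apply: fixs; exists y.
  by rewrite [s](divz_eq s r) addrC frobzD mulrC frobz_dim.
pose p : {poly E} := 'X^(#|F| ^ j) - 'X.
have qj_gt1 : (1 < #|F| ^ j)%N by rewrite -(expn0 #|F|) ltn_exp2l.
have sp : size p = (#|F| ^ j).+1.
  by rewrite size_polyDl size_polyXn // size_polyN size_polyX ltnS.
have p0 : p != 0 by rewrite -size_poly_eq0 sp.
pose ys : seq E := enum (finvect_type E).
have sz_ys : size ys = (#|F| ^ r)%N by rewrite -card_fieldExt cardE.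
have all_roots : all (root p) ys.
  by apply/allP => y _; rewrite rootE !hornerE fixj subrr.
have := max_poly_roots p0 all_roots (enum_uniq _).
by rewrite sp sz_ys ltnS leq_exp2l // leqNgt jr'.
Qed.

End FrobeniusPowers.

(** * Spans and freeness of families indexed by a duplicate-free sequence *)

Section Families.
Variables (K : fieldType) (V : vectType K) (I : eqType) (g : I -> V).

Lemma mem_span_map (s : seq I) (v : V) : uniq s -> v \in <<map g s>>%VS ->
  exists c : I -> K, v = \sum_(i <- s) c i *: g i.
Proof.
elim: s v => [|i s IHs] v /=.
  by move=> _; rewrite span_nil memv0 => /eqP ->; exists (fun=> 0); rewrite big_nil.
case/andP=> si us; rewrite span_cons => /memv_addP[_ /vlineP[k ->]].
case=> v' /(IHs _ us)[c ->] ->.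
exists (fun j => if j == i then k else c j); rewrite big_cons eqxx; congr (_ + _).
by apply: eq_big_seq => j js; case: eqP => // ji; rewrite -ji js in si.
Qed.

Lemma free_map (s : seq I) : uniq s ->
  (forall c : I -> K, \sum_(i <- s) c i *: g i = 0 -> {in s, c =1 fun=> 0}) ->
  free (map g s).
Proof.
elim: s => [|i s IHs] /=; first by rewrite nil_free.
case/andP=> si us hs; rewrite free_cons.
have ext (c : I -> K) k : \sum_(j <- i :: s) (if j == i then k else c j) *: g j
    = k *: g i + \sum_(j <- s) c j *: g j.
  rewrite big_cons eqxx; congr (_ + _); apply: eq_big_seq => j js.
  by case: eqP => // ji; rewrite -ji js in si.
apply/andP; split.
  apply/negP => /(mem_span_map us)[c gi].
  have := hs (fun j => if j == i then -1 else c j).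
  rewrite ext scaleN1r -gi addNr => /(_ erefl i); rewrite mem_head eqxx.
  by move=> /(_ isT) /eqP; rewrite oppr_eq0 oner_eq0.
apply: IHs => // c c0 j js; have := hs (fun j => if j == i then 0 else c j).
rewrite ext c0 scale0r addr0 => /(_ erefl j); rewrite in_cons js orbT.
by case: eqP => [ji|_ ->//]; rewrite -ji js in si.
Qed.

End Families.

(** * Coordinates in a basis of L, and a generator of Z^m modulo L *)

Section LatticeData.
Variables (m r : nat) (e : 'rV[int]_m).

Lemma dotzZr c u : dotz e (c *: u) = c * dotz e u.
Proof.
by rewrite /dotz mulr_sumr; apply: eq_bigr => i _; rewrite mxE mulrCA.
Qed.

Lemma dotzBr u v : dotz e (u - v) = dotz e u - dotz e v.
Proof. by rewrite dotzDr dotzNr. Qed.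

Lemma dotz_bezout :
  exists z, dotz e z = (\big[gcdn/0%N]_(i < m) absz (e 0 i))%:Z.
Proof.
elim/big_ind: _ => [|x y [u ux] [v vy]|i _]; first by exists 0; rewrite dotz0r.
  have [a [b abE]] := Bezoutz x y.
  by exists (a *: u + b *: v); rewrite dotzDr !dotzZr ux vy abE.
exists (Num.sg (e 0 i) *: delta_mx 0 i); rewrite dotzZr /dotz (bigD1 i) //=.
rewrite big1 => [|j /negPf ji]; last by rewrite mxE ji mulr0.
by rewrite mxE !eqxx mulr1 addr0 -normrEsg abszE.
Qed.

(** By Bezout, the product with e maps Z^m onto Z/r; its kernel there is L, so z generates Z^m
    modulo L. *)
Lemma dotz_one : gcdn (\big[gcdn/0%N]_(i < m) absz (e 0 i)) r = 1%N ->
  exists z, (r %| dotz e z - 1)%Z.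
Proof.
have [z zE] := dotz_bezout; set g := \big[_/_]_(_ < _) _ in zE *.
have [a [b abE]] := Bezoutz g r; move=> gr1.
exists (a *: z); rewrite dotzZr zE; have -> : a * g%:Z = 1 - b * r.
  apply/eqP; rewrite eq_sym subr_eq addrC; apply/eqP.
  by rewrite addrC abE /gcdz gr1.
by rewrite addrAC subrr add0r -mulNr dvdz_mull.
Qed.

Variable w : 'I_m -> 'rV[int]_m.
Hypothesis w_basis : lattice_basis r e w.
Local Notation W := (\matrix_i w i).

Let aW (a : 'rV[int]_m) : a *m W = \sum_i a 0 i *: w i.
Proof. by rewrite mulmx_sum_row; apply: eq_bigr => i _; rewrite rowK. Qed.

Lemma lattice_memP u :
  (r %| dotz e u)%Z <-> exists a : 'rV[int]_m, u = a *m W.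
Proof.
have [wL w_ex] := w_basis.
split=> [uL|[a ->]].
  have [a [-> _]] := w_ex u uL; exists (\row_i a i).
  by rewrite aW; apply: eq_bigr => i _; rewrite mxE.
rewrite aW; elim/big_ind: _ => [|x y rx ry|i _]; first by rewrite dotz0r dvdz0.
  by rewrite dotzDr rpredD.
by rewrite dotzZr dvdz_mull //; apply: wL.
Qed.

Lemma basis_mulmx_inj k : injective (fun A : 'M[int]_(k, m) => A *m W).
Proof.
have [wL w_ex] := w_basis.
move=> A A' /= AA'; apply/row_matrixP => i.
have {}AA' : row i A *m W = row i A' *m W by rewrite -!row_mul AA'.
have rL : row i A *m W \in lattice r e by apply/lattice_memP; exists (row i A).
have [b [_ b_uniq]] := w_ex _ rL.
have bA := b_uniq (fun j => row i A 0 j) (aW _).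
have bA' := b_uniq (fun j => row i A' 0 j) (etrans AA' (aW _)).
by apply/rowP => j; rewrite -[LHS]/((fun j => row i A 0 j) j) -bA bA'.
Qed.

(** As r Z^m lies in L, each [r%:Z *: delta_mx 0 i] has integral coordinates in the basis, which
    form row i of B. The second product follows from W B W = r W by cancelling W on the right. *)
Lemma basis_dual : exists B : 'M[int]_m, B *m W = r%:Z%:M /\ W *m B = r%:Z%:M.
Proof.
have row_ex i : exists b : 'rV[int]_m, r%:Z *: delta_mx 0 i = b *m W.
  by apply/lattice_memP; rewrite dotzZr dvdz_mulr.
have [b bW] := choice row_ex; pose B := \matrix_i b i.
have BW : B *m W = r%:Z%:M.
  by apply/row_matrixP => i; rewrite row_mul rowK -bW -scalemx1 linearZ /= row1.
exists B; split=> //; apply: basis_mulmx_inj.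
by rewrite -mulmxA BW scalar_mxC.
Qed.

End LatticeData.

(* [basis] has the w_i as rows and [dual] is r times its inverse, so that the
   coordinates of u in the basis w are those of [u *m dual] divided by r; [gen]
   generates Z^m modulo L.                                                    *)
Record frame (m r : nat) (e : 'rV[int]_m) := Frame {
  basis : 'M[int]_m;
  dual : 'M[int]_m;
  gen : 'rV[int]_m;
  gen_coord : 'I_m -> nat;
  dualK : dual *m basis = r%:Z%:M;
  basisK : basis *m dual = r%:Z%:M;
  lattice_spanP : forall u,
    (r %| dotz e u)%Z <-> exists a : 'rV[int]_m, u = a *m basis;
  dotz_gen : (r %| dotz e gen - 1)%Z;
  gen_dual : forall i, (gen *m dual) 0 i = gen_coord i }.

Lemma frame_exists (m r : nat) (e : 'rV[int]_m) (w : 'I_m -> 'rV[int]_m) :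
  (0 < r)%N -> gcdn (\big[gcdn/0%N]_(i < m) absz (e 0 i)) r = 1%N ->
  lattice_basis r e w -> exists D : frame r e, basis D = \matrix_i w i.
Proof.
move=> r_gt0 er w_basis; have [B [BW WB]] := basis_dual w_basis.
have spanP := lattice_memP w_basis; set W := \matrix_i w i in BW WB spanP *.
have [z ez] := dotz_one er.
(* Removing the integral parts of the coordinates moves z, within its class modulo L, into the
   half-open cell of the basis; r times its coordinates are then natural numbers. *)
pose d : 'rV[int]_m := \row_i divz ((z *m B) 0 i) r.
have ez' : (r %| dotz e (z - d *m W) - 1)%Z.
  rewrite dotzBr addrAC rpredB //; first by apply/spanP; exists d.
have zB i : ((z - d *m W) *m B) 0 i = absz (modz ((z *m B) 0 i) r).
  rewrite gez0_abs ?modz_ge0 ?gt_eqF // /modz mulmxBl -mulmxA WB mul_mx_scalar.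
  by rewrite !mxE mulrC.
by exists (Frame BW WB spanP ez' zB).
Qed.

(** * Points with nonnegative coordinates, parametrized by a class modulo L and integral parts *)

Section Points.
Variables (m r : nat) (e : 'rV[int]_m) (D : frame r e).
Hypothesis r_gt0 : (0 < r)%N.
Local Notation W := (basis D).
Local Notation B := (dual D).
Local Notation phi := (gen_coord D).

Lemma dual_inj : injective (fun u : 'rV[int]_m => u *m B).
Proof.
move=> u v /= /(congr1 (fun x => x *m W)); rewrite -!mulmxA dualK !mul_mx_scalar.
move/rowP=> uv; apply/rowP => i; have := uv i; rewrite !mxE.
by apply: mulfI; rewrite gt_eqF.
Qed.

(** This is r times the fractional part of the i-th coordinate of [s%:Z *: gen D]. *)
Definition frac_part (s : nat) (i : 'I_m) : nat := (s * phi i) %% r.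

(** The subtracted quotients bring [s%:Z *: gen D] into the half-open cell of the basis; [a] then
    gives the integral parts of the coordinates. *)
Definition point (s : nat) (a : 'I_m -> nat) : 'rV[int]_m :=
  s%:Z *: gen D + (\row_i ((a i)%:Z - ((s * phi i) %/ r)%N%:Z)) *m W.

Lemma point_dual s a i :
  (point s a *m B) 0 i = (frac_part s i + r * a i)%N.
Proof.
rewrite mulmxDl -scalemxAl -mulmxA basisK mul_mx_scalar.
rewrite mxE [X in X + _]mxE gen_dual !mxE.
have := divn_eq (s * phi i) r; rewrite /frac_part; move: (_ %/ _)%N (_ %% _)%N.
move=> q k /(congr1 Posz); rewrite PoszM => ->.
by rewrite !PoszD !PoszM; ring.
Qed.

Lemma dotz_point s a : (r %| dotz e (point s a) - s%:Z)%Z.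
Proof.
rewrite dotzDr dotzZr addrAC -[X in _ * _ - X]mulr1 -mulrBr rpredD //.
  by rewrite dvdz_mull // dotz_gen.
by apply/lattice_spanP; eexists.
Qed.

(** For s = e.u mod r, the point u differs from the cell point of class s by an element of L, with
    coordinates b_i. Since r b_i plus a number below r is nonnegative, so is b_i. *)
Lemma point_surj u : (forall i, 0 <= (u *m B) 0 i) ->
  exists (s : 'I_r) (a : 'I_m -> nat), u = point s a.
Proof.
move=> u_ge0; have r0 : r%:Z != 0 by rewrite gt_eqF.
have sr : (`|(dotz e u %% r)%Z| < r)%N.
  by rewrite -ltz_nat gez0_abs ?modz_ge0 ?ltz_pmod.
pose s := Ordinal sr.
have [b bE] : exists b : 'rV[int]_m, u - point s (fun=> 0%N) = b *m W.
  apply/lattice_spanP; rewrite dotzBr.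
  have -> : dotz e u - dotz e (point s (fun=> 0%N)) =
    dotz e u - s%:Z - (dotz e (point s (fun=> 0%N)) - s%:Z).
    by rewrite opprB addrA subrK.
  rewrite rpredB ?dotz_point //= gez0_abs ?modz_ge0 // -eqz_mod_dvd.
  by rewrite modz_mod.
have b_ge0 i : 0 <= b 0 i.
  have := u_ge0 i; rewrite -[u](subrK (point s (fun=> 0%N))) bE mulmxDl mxE.
  rewrite point_dual -mulmxA basisK mul_mx_scalar mxE muln0 addn0.
  have : (frac_part s i < r)%N by rewrite ltn_pmod.
  move: (frac_part s i) (b 0 i) => f x fr h; rewrite leNgt; apply/negP => x0.
  have : 0 <= r%:Z * (- 1 - x) by rewrite mulr_ge0 //; lia.
  rewrite mulrBr mulrN1; lia.
exists s, (fun i => absz (b 0 i)).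
rewrite -[u](subrK (point s (fun=> 0%N))) bE /point addrCA -mulmxDl.
congr (_ + _ *m _).
by apply/rowP => i; rewrite !mxE gez0_abs // sub0r addrC.
Qed.

Lemma point_inj s s' a a' : (s < r)%N -> (s' < r)%N ->
  point s a = point s' a' -> s = s' /\ a =1 a'.
Proof.
move=> sr sr' pp; have ss' : s = s'.
  have := dotz_point s a; have := dotz_point s' a'; rewrite -pp => d' d.
  have : (s%:Z == s'%:Z %[mod r])%Z.
    rewrite eqz_mod_dvd; have := rpredB d' d.
    by rewrite opprB addrC addrA subrK.
  by rewrite !modz_small ?ltr0n // => /eqP[].
split=> // i; rewrite -ss' in pp.
have := congr1 (fun u => (u *m B) 0 i) pp; rewrite !point_dual.
by case=> /addnI/eqP; rewrite eqn_pmul2l // => /eqP.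
Qed.

End Points.

(** * Characters of L: products and coordinate characters *)

Section LatticeCharacters.
Variables (F : finFieldType) (E : fieldExtType F) (m : nat) (e : 'rV[int]_m).
Local Notation r := (\dim {:E}).

Definition latchar_one : latchar E e :=
  @LatChar F E m e (fun=> 1%g) (fun _ _ => esym (mulg1 1%g)).

Fact latchar_mulD (g h : latchar E e) u v :
  (g (u + v) * h (u + v) = (g u * h u) * (g v * h v))%g.
Proof.
rewrite !latcharD; apply: val_inj => /=.
by rewrite mulrACA.
Qed.

Definition latchar_mul (g h : latchar E e) : latchar E e :=
  @LatChar F E m e (fun u => (g u * h u)%g) (latchar_mulD g h).

Lemma expg_absz_modz (gT : finGroupType) (x : gT) (j k : int) :
  (x ^+ absz (modz (j + k)%R #[x]%g) =
     x ^+ absz (modz j #[x]%g) * x ^+ absz (modz k #[x]%g))%g.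
Proof.
have x0 : #[x]%g%:Z != 0 by rewrite gt_eqF // ltz_nat order_gt0.
rewrite -expgD; apply/eqP; rewrite eq_expg_mod_order -eqz_nat -!modz_nat.
by rewrite PoszD !gez0_abs ?modz_ge0 // modz_mod modzDm.
Qed.

Variable D : frame r e.
Local Notation W := (basis D).

(** F_q^* is cyclic of order q - 1: with x a generator, take g(u) = x^(a_i), where a_i is the i-th
    coordinate of u. *)
Lemma coord_latchar (i : 'I_m) : exists g : latchar E e,
  forall (u : lat r e) (a : 'rV[int]_m), lat_val u = a *m W ->
    (g u == 1%g) = (#|F|.-1 %| a 0%R i)%Z.
Proof.
have r_gt0 : (0 < r)%N by apply: adim_gt0.
have r0 : r%:Z != 0 by rewrite gt_eqF.
have /cyclicP[x xG] := field_unit_group_cyclic [set: {unit F}]%G.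
have ox : #[x]%g = #|F|.-1 by rewrite -card_finField_unit orderE -xG.
pose k (u : lat r e) : int := divz ((lat_val u *m dual D) 0 i) r.
have kE u (a : 'rV[int]_m) : lat_val u = a *m W -> k u = a 0 i.
  by rewrite /k => ->; rewrite -mulmxA basisK mul_mx_scalar mxE mulKz.
have kD u v : k (u + v) = k u + k v.
  have /(lattice_spanP D)[a uE] := lat_valP u.
  have /(lattice_spanP D)[b vE] := lat_valP v.
  rewrite (kE u a uE) (kE v b vE) (kE (u + v) (a + b)) ?mxE //.
  by rewrite lat_valD uE vE mulmxDl.
pose g u : {unit F} := (x ^+ absz (modz (k u) #[x]%g))%g.
have gD u v : g (u + v) = (g u * g v)%g by rewrite /g kD expg_absz_modz.
exists (LatChar gD) => u a ua /=; rewrite /g (kE u a ua) -order_dvdn -ox.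
set d := #[x]%g; have d0 : d%:Z != 0 by rewrite gt_eqF // ltz_nat order_gt0.
apply/idP/dvdz_mod0P => [|->]; last exact: dvdn0.
case: (posnP (absz (modz (a 0 i) d))) => [/eqP|k0 /dvdn_leq].
  by rewrite absz_eq0 => /eqP.
move=> /(_ k0); rewrite leqNgt -ltz_nat gez0_abs ?modz_ge0 //.
by rewrite ltz_pmod // ltz_nat order_gt0.
Qed.

End LatticeCharacters.

(** * Linear independence of the monomial images over the box *)

Section Independence.
Variables (F : finFieldType) (E : fieldExtType F) (m : nat) (e : 'rV[int]_m).
Local Notation r := (\dim {:E}).
Local Notation n := #|F|.-1.
Variables (D : frame r e) (t : latchar E e -> 'rV[int]_m -> E).
Hypothesis t_ext : forall g : latchar E e, cocycle_extension g (t g).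
Local Notation W := (basis D).
Local Notation B := (dual D).

(** The value at x of the component at g of the image of X^u. *)
Definition twist g u (x : E) : E := t g u * frobz E (dotz e u) x.

Lemma twistM g u x y : twist g u (x * y) = twist g u x * frobz E (dotz e u) y.
Proof. by rewrite /twist frobzM mulrA. Qed.

Lemma twistD g u v x : twist g (u + v) x = twist g u (twist g v x).
Proof.
have [_ _ tD] := t_ext g.
by rewrite /twist tD dotzDr frobzD frobzM mulrA.
Qed.

Lemma cocycle_neq0 g u : t g u != 0.
Proof. by have [] := t_ext g. Qed.

Lemma cocycle_latticeD g (u : 'rV[int]_m) (l : lat r e) :
  t g (u + lat_val l) = t g u * (FinRing.uval (g l))%:A.
Proof. by have [_ tL tD] := t_ext g; rewrite tD tL frobz_scalar. Qed.

Lemma frobz_latticeD (u : 'rV[int]_m) (l : lat r e) x :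
  frobz E (dotz e (u + lat_val l)) x = frobz E (dotz e u) x.
Proof.
have /dvdzP[k lE] := lat_valP l.
by rewrite dotzDr lE mulrC frobzD frobz_dim.
Qed.

Definition reduced (u : 'rV[int]_m) :=
  [forall i, 0 <= (u *m B) 0 i < (r * n)%N%:Z].

Lemma reducedP u :
  reflect (forall i, 0 <= (u *m B) 0 i < (r * n)%N%:Z) (reduced u).
Proof. exact: forallP. Qed.

(** The i-th entry of (u - v) B is r a_i, a multiple of r(q-1) of absolute value below r(q-1), hence
    zero. *)
Lemma reduced_separated u v (a : 'rV[int]_m) : reduced u -> reduced v ->
  u - v = a *m W -> (forall i, (n %| a 0%R i)%Z) -> u = v.
Proof.
move=> /reducedP ru /reducedP rv uv na; apply: (@dual_inj _ _ _ D (adim_gt0 _)).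
apply/rowP => i; have := congr1 (fun x => (x *m B) 0 i) uv.
rewrite mulmxBl mxE [X in _ + X]mxE -mulmxA basisK mul_mx_scalar [RHS]mxE.
have [k ->] := dvdzP (na i).
have := ru i; have := rv i; move: ((u *m B) 0 i) ((v *m B) 0 i) => x y.
rewrite mulrCA -PoszM; move: (r * n)%N => N /andP[y0 yN] /andP[x0 xN] xy.
have : k = 0.
  case: (ltgtP k 0) => // k0.
    have : N%:Z * 1 <= N%:Z * - k by rewrite ler_wpM2l //; lia.
    by lia.
  have : N%:Z * 1 <= N%:Z * k by rewrite ler_wpM2l //; lia.
  lia.
by move=> k0; apply/eqP; rewrite -subr_eq0 xy k0 mul0r.
Qed.

Lemma lattice_sub u v :
  (r %| dotz e u - dotz e v)%Z -> exists l : lat r e, u = v + lat_val l.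
Proof.
move=> uv; have uvL : u - v \in lattice r e by rewrite inE dotzBr.
by exists (Lat uvL); rewrite addrC subrK.
Qed.

(* Dedekind's argument: a relation is shortened by comparing it with its
   composite with multiplication by y, then with its translate under the action
   of a character h on the set of characters.                                 *)
Lemma twist_free (s : seq 'rV[int]_m) (a : 'rV[int]_m -> E) :
  uniq s -> all reduced s ->
  (forall g x, \sum_(u <- s) a u * twist g u x = 0) -> {in s, a =1 fun=> 0}.
Proof.
elim: s a => [//|u s IHs] a /=; case/andP=> us s_uniq /andP[red_u red_s] rel.
have step1 y : {in s, forall v,
    a v * (frobz E (dotz e v) y - frobz E (dotz e u) y) = 0}.
  apply: IHs => // g x.
  have := rel g (x * y); have := congr1 ( *%R (frobz E (dotz e u) y)) (rel g x).
  rewrite mulr0 mulr_sumr => r1 r2.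
  have := congr2 (fun x y => x - y) r2 r1; rewrite subr0 -sumrB big_cons.
  rewrite twistM mulrA [X in X - _]mulrC subrr add0r => r3; rewrite -[RHS]r3.
  by apply: eq_bigr => v _; rewrite twistM; ring.
(* If [a v] is nonzero, [step1] makes the Frobenius power of exponent e.v - e.u fix every y, so r
   divides this exponent. *)
have a_lat v : v \in s -> a v != 0 -> exists l : lat r e, v = u + lat_val l.
  move=> vs av; apply: lattice_sub; apply: contraT => /frobz_moves[y /eqP[]].
  have := step1 (frobz E (- dotz e u) y) v vs => /eqP.
  rewrite mulf_eq0 (negPf av) /= subr_eq0 -!frobzD subrr frobz0.
  by move/eqP.
have step2 (h : latchar E e) : {in s, forall v,
    a v * ((FinRing.uval (h (insubd 0 (v - u))))%:A - 1) = 0}.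
  apply: IHs => // g x; pose gh := latchar_mul g h.
  (* The factor [t g u / t gh u] equalizes the two terms at u; at v = u + l the two terms then
     differ by the factor h(l). *)
  have := rel g x; have := congr1 ( *%R (t g u / t gh u)) (rel gh x).
  rewrite mulr0 mulr_sumr => r1 r2.
  have := congr2 (fun x y => x - y) r1 r2; rewrite subr0 -sumrB big_cons.
  have -> : t g u / t gh u * (a u * twist gh u x) - a u * twist g u x = 0.
    by rewrite /twist; field; apply: cocycle_neq0.
  rewrite add0r => r3; rewrite -[RHS]r3; apply: eq_big_seq => v vs.
  have [->|av] := eqVneq (a v) 0; first by rewrite !mul0r mulr0 subrr.
  have [l vE] := a_lat v vs av.
  have -> : insubd 0 (v - u) = l by rewrite vE addrC addKr valKd.
  rewrite vE /twist frobz_latticeD !cocycle_latticeD.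
  have -> : (FinRing.uval (gh l))%:A =
      (FinRing.uval (g l))%:A * (FinRing.uval (h l))%:A :> E.
    by rewrite /= -scalerAl mul1r scalerA.
  by field; apply: cocycle_neq0.
(* If [a v] were nonzero, every coordinate character would be trivial on v - u; then v - u would lie
   in (q-1)L, and two points of the box would coincide. *)
have a_s : {in s, a =1 fun=> 0}.
  move=> v vs; apply/eqP; apply: contraT => av.
  have [l vE] := a_lat v vs av.
  have /(lattice_spanP D)[b lE] := lat_valP l.
  case/negP: us; suff <- : v = u by [].
  apply: (reduced_separated (allP red_s v vs) red_u (a := b)) => [|i].
    by rewrite vE addrC addKr.
  have [h hE] := coord_latchar D i; rewrite -(hE l b lE).
  have := step2 h v vs => /eqP; rewrite mulf_eq0 (negPf av) /= subr_eq0.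
  have -> : insubd 0 (v - u) = l by rewrite vE addrC addKr valKd.
  move=> /eqP h1; apply/eqP/val_inj => /=.
  by apply: (fmorph_inj (in_alg E)); rewrite /= h1 scale1r.
move=> v; rewrite in_cons => /predU1P[->|]; last exact: a_s.
have := rel (latchar_one E e) 1; rewrite big_cons big1_seq => [|x /andP[_ xs]].
  rewrite addr0 /twist frobz1 mulr1 => /eqP.
  by rewrite mulf_eq0 (negPf (cocycle_neq0 _ _)) orbF => /eqP.
by rewrite a_s // mul0r.
Qed.

Definition reduction (u : 'rV[int]_m) : 'rV[int]_m :=
  u - (\row_i divz ((u *m B) 0 i) (r * n)%N) *m W *+ n.

Lemma reduction_dual u i :
  (reduction u *m B) 0 i = modz ((u *m B) 0 i) (r * n)%N.
Proof.
rewrite mulmxBl -scaler_nat -scalemxAl -mulmxA basisK mul_mx_scalar.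
rewrite mxE [X in _ + X]mxE [X in _ - X]mxE [X in _ * X]mxE mxE /modz.
by rewrite natz PoszM !mxE; ring.
Qed.

(** Shifts by (q-1)L act trivially: character values have order dividing q - 1, and r divides e.l
    for l in L. *)
Lemma twist_reduction g u x : twist g (reduction u) x = twist g u x.
Proof.
pose d : 'rV[int]_m := \row_i divz ((u *m B) 0 i) (r * n)%N.
have dL : d *m W \in lattice r e by apply/(lattice_spanP D); exists d.
have {2}-> : u = reduction u + lat_val (Lat dL *+ n).
  by rewrite lat_valMn subrK.
rewrite /twist cocycle_latticeD frobz_latticeD latcharMn.
by rewrite -card_finField_unit expg_cardG ?finset.in_setT //= scale1r mulr1.
Qed.

(** Terms are grouped by reduced exponent, which determines the map; [twist_free] then applies to
    the distinct reduced exponents. *)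
Lemma twist_relation (J : eqType) (s : seq J) (c : J -> E)
    (p : J -> 'rV[int]_m) :
  (forall g x, \sum_(j <- s) c j * twist g (p j) x = 0) ->
  forall u, \sum_(j <- s | reduction (p j) == u) c j = 0.
Proof.
move=> rel u; have q_gt1 : (1 < #|F|)%N := finNzRing_gt1 F.
have rn_gt0 : (0 < r * n)%N by rewrite muln_gt0 adim_gt0 -subn1 subn_gt0.
pose S := undup [seq reduction (p j) | j <- s].
have [uS|uS] := boolP (u \in S); last first.
  rewrite big1_seq // => j /andP[/eqP ju js]; case/negP: uS.
  by rewrite mem_undup -ju (map_f (reduction \o p)).
apply: (@twist_free S (fun v => \sum_(j <- s | reduction (p j) == v) c j)) => //.
- exact: undup_uniq.
- apply/allP => v; rewrite mem_undup => /mapP[j _ ->].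
  apply/reducedP => i; rewrite reduction_dual modz_ge0 ?gt_eqF //=.
  by rewrite ltz_pmod.
move=> g x; rewrite -[RHS](rel g x).
transitivity (\sum_(v <- S) \sum_(j <- s | reduction (p j) == v)
    c j * twist g (p j) x).
  apply: eq_bigr => v _; rewrite mulr_suml; apply: eq_bigr => j /eqP <-.
  by rewrite twist_reduction.
rewrite (exchange_big_dep xpredT) //=; apply: eq_big_seq => j js.
rewrite -big_filter (@eq_filter _ _ (pred1 (reduction (p j)))) => [|v].
  rewrite filter_pred1_uniq ?undup_uniq ?big_seq1 // mem_undup.
  by rewrite (map_f (reduction \o p)).
by rewrite eq_sym.
Qed.

End Independence.

(** * Leading terms, digit expansions and the counting of residue vectors *)

Lemma seq_argmax (T : eqType) (w : T -> int) (s : seq T) : s != [::] ->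
  exists2 x, x \in s & {in s, forall y, w y <= w x}.
Proof.
elim: s => // x s IHs _; have [->|/IHs[y ys ymax]] := eqVneq s [::].
  by exists x; rewrite ?mem_head // => y; rewrite mem_seq1 => /eqP ->.
have [xy|yx] := lerP (w x) (w y).
  exists y => [|z]; rewrite in_cons ?ys ?orbT // => /predU1P[->//|]; exact: ymax.
exists x => [|z]; rewrite in_cons ?eqxx // => /predU1P[->//|/ymax zy].
exact: le_trans zy (ltW yx).
Qed.

Lemma base_expansion_inj (N : nat) (m : nat) (x y : 'I_m -> int) :
  (forall i, 0 <= x i < N%:Z) -> (forall i, 0 <= y i < N%:Z) ->
  \sum_i x i * N%:Z ^+ i = \sum_i y i * N%:Z ^+ i -> x =1 y.
Proof.
elim: m x y => [|m IHm] x y xN yN; first by move=> _ [].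
have shift (z : 'I_m.+1 -> int) : \sum_i z i * N%:Z ^+ i =
    z ord0 + N%:Z * \sum_(i < m) z (lift ord0 i) * N%:Z ^+ i.
  rewrite big_ord_recl expr0 mulr1 mulr_sumr; congr (_ + _).
  by apply: eq_bigr => i _; rewrite exprS mulrCA.
rewrite !shift => xy.
have modE a X : 0 <= a < N%:Z -> modz (a + N%:Z * X) N = a.
  by move=> aN; rewrite addrC mulrC modzMDl modz_small // absz_nat.
have xy0 : x ord0 = y ord0.
  by have := congr1 (modz^~ N) xy; rewrite !modE.
have N0 : N%:Z != 0 by have := xN ord0; case: (N) => // /andP[/le_lt_trans h /h].
have xyl := IHm (x \o lift ord0) (y \o lift ord0) (fun i => xN _) (fun i => yN _).
have {}xyl : x \o lift ord0 =1 y \o lift ord0.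
  by apply: xyl; move: xy; rewrite xy0 => /addrI/(mulfI N0).
by move=> i; case: (unliftP ord0 i) => [j|] ->; [apply: xyl|].
Qed.

(* Multiplication by f maps Z/r onto the multiples of g = gcd f r, with fibres
   of size g: a multiple v < b of g comes from g pairs, which can be sent
   injectively to v, v + 1, ..., v + g - 1; and v + g <= b.                   *)
Lemma card_residues_below (r n f s0 a0 : nat)
    (b := ((s0 * f) %% r + r * a0)%N) : (0 < r)%N ->
  (#|[set p : 'I_r * 'I_n | (p.1 * f) %% r + r * p.2 < b]| <= b)%N.
Proof.
move=> r_gt0; set A := [set p | _]; pose g := gcdn f r; pose rho := (r %/ g)%N.
have g_gt0 : (0 < g)%N by rewrite gcdn_gt0 r_gt0 orbT.
have rE : r = (rho * g)%N by rewrite divnK ?dvdn_gcdr.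
have rho_gt0 : (0 < rho)%N by move: r_gt0; rewrite rE muln_gt0 => /andP[].
pose v s a := ((s * f) %% r + r * a)%N.
have gv s a : (g %| v s a)%N.
  rewrite dvdn_addl ?dvdn_mulr ?dvdn_gcdr //.
  rewrite -(dvdn_addl _ (dvdn_mull ((s * f) %/ r) (dvdn_gcdr f r))) addnC.
  by rewrite -divn_eq dvdn_mull // dvdn_gcdl.
(* Pairs with equal v have equal second entries and first entries congruent modulo rho, so
   [p.1 %/ rho] tells them apart by numbers below g. *)
pose h (p : 'I_r * 'I_n) := (v p.1 p.2 + p.1 %/ rho)%N.
have kg (s : 'I_r) : (s %/ rho < g)%N by rewrite ltn_divLR // mulnC -rE.
have hA : {subset map h (enum A) <= iota 0 b}.
  move=> _ /mapP[p + ->]; rewrite mem_enum inE mem_iota /= add0n => pb.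
  have vb : (v p.1 p.2 < b)%N := pb.
  have [x vE] := dvdnP (gv p.1 p.2); have [y bE] := dvdnP (gv s0 a0).
  rewrite /h; move: vb (kg p.1); rewrite /b -/(v s0 a0) vE bE ltn_pmul2r // => xy.
  have : (x.+1 * g <= y * g)%N by rewrite leq_mul2r xy orbT.
  by rewrite mulSn; lia.
have h_inj : {in enum A &, injective h}.
  move=> [s a] [s' a'] _ _; rewrite /h /= => hh.
  have vv : v s a = v s' a'.
    have [x vE] := dvdnP (gv s a); have [y v'E] := dvdnP (gv s' a').
    rewrite vE v'E in hh *; have := congr1 (divn^~ g) hh.
    by rewrite !divnMDl // !(divn_small (kg _)) !addn0 => ->.
  have ss : (s %/ rho = s' %/ rho)%N by move: hh; rewrite vv => /addnI.
  have aa : a = a'.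
    apply: val_inj; have := congr1 (divn^~ r) vv.
    rewrite /v ![(_ %% r + _)%N]addnC ![(r * _)%N]mulnC !divnMDl //.
    by rewrite !divn_small ?addn0 ?ltn_pmod.
  have sf : (s * f = s' * f %[mod r])%N by move: vv; rewrite /v aa => /addIn.
  congr (_, _) => //; apply: val_inj => /=.
  rewrite (divn_eq s rho) (divn_eq s' rho) ss; congr (_ + _)%N.
  have fE : f = (f %/ g * g)%N by rewrite divnK ?dvdn_gcdl.
  (* As f/g is invertible modulo rho, s f = s' f modulo r means s = s' modulo rho. *)
  have cop : coprime rho (f %/ g).
    rewrite coprime_sym /coprime -(eqn_pmul2r g_gt0) muln_gcdl -fE -rE mul1n.
    by rewrite eqxx.
  wlog ss' : s s' sf {hh vv ss} / (s' <= s)%N.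
    by move=> H; case/orP: (leq_total s' s) => ?; [|symmetry]; apply: H.
  apply/eqP; rewrite eqn_mod_dvd // -(Gauss_dvdl _ cop) -(dvdn_pmul2r g_gt0).
  by rewrite -rE -mulnA -fE mulnBl -eqn_mod_dvd ?leq_mul2r ?ss' ?orbT //; apply/eqP.
rewrite cardE -(size_map h) -[leqRHS](size_iota 0).
by apply: uniq_leq_size => //; rewrite map_inj_in_uniq ?enum_uniq.
Qed.

Lemma card_ffun_at (m n : nat) (i : 'I_m) (Q : {set 'I_n}) :
  #|[set a : {ffun 'I_m -> 'I_n} | a i \in Q]| = (#|Q| * n ^ m.-1)%N.
Proof.
pose P (j : 'I_m) : {pred 'I_n} := [pred x | (j == i) ==> (x \in Q)].
have -> : #|[set a : {ffun 'I_m -> 'I_n} | a i \in Q]| = #|family P|.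
  apply: eq_card => a; rewrite inE; apply/idP/familyP => [ai j|/(_ i)].
    by rewrite inE; apply/implyP => /eqP ->.
  by rewrite inE eqxx.
rewrite card_family.
have -> : foldr muln 1%N [seq #|P j| | j : 'I_m] = (\prod_j #|P j|)%N.
  by rewrite /image_mem foldrE big_map enumT.
rewrite (bigD1 i) //= (@eq_card _ (P i) (mem Q)) => [|x]; last by rewrite !inE eqxx.
congr (_ * _)%N; rewrite (eq_bigr (fun=> n)) => [|j /negPf ji]; last first.
  by rewrite -[RHS](card_ord n); apply: eq_card => x; rewrite !inE ji.
by rewrite prod_nat_const cardC1 card_ord.
Qed.

(** Union bound: failure at coordinate i involves only s and a_i and leaves the other m - 1 entries
    free, so it occurs at most b_i n^(m-1) times among r n^m. *)
Lemma card_residue_vectors_above (r n m : nat) (f : 'I_m -> nat) (s0 : nat)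
    (a0 : 'I_m -> nat) (b := fun i => ((s0 * f i) %% r + r * a0 i)%N) :
  (0 < r)%N -> (0 < m)%N ->
  (r * n ^ (m - 1) * n - n ^ (m - 1) * \sum_i b i <=
    #|[set k : 'I_r * {ffun 'I_m -> 'I_n} |
        [forall i, b i <= (k.1 * f i) %% r + r * k.2 i]]|)%N.
Proof.
move=> r_gt0 m_gt0; set A := [set k | _].
pose bad i := [set k : 'I_r * {ffun 'I_m -> 'I_n} |
   ((k.1 * f i) %% r + r * k.2 i < b i)%N].
have card_bad i : (#|bad i| <= n ^ (m - 1) * b i)%N.
  have := card_residues_below n (f i) s0 (a0 i) r_gt0; rewrite -/(b i).
  set P := [set p | _] => Pb.
  rewrite (leq_trans _ (leq_mul (leqnn _) Pb)) // mulnC -!sum1dep_card.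
  rewrite -(pair_big_dep xpredT (fun (s : 'I_r) (a : {ffun 'I_m -> 'I_n}) => 
     ((s * f i) %% r + r * a i < b i)%N) (fun _ _ => 1%N)) /=.
  rewrite -(pair_big_dep xpredT (fun (s : 'I_r) (a : 'I_n) => 
     ((s * f i) %% r + r * a < b i)%N) (fun _ _ => 1%N)) /=.
  rewrite big_distrl /= leq_sum // => s _; rewrite !sum1dep_card.
  rewrite subn1 -(card_ffun_at i [set al : 'I_n | _]); apply: eq_leq.
  by apply: eq_card => a; rewrite !inE.
have AC : (#|~: A| <= n ^ (m - 1) * \sum_i b i)%N.
  apply: (@leq_trans #|\bigcup_i bad i|).
    apply/subset_leq_card/fintype.subsetP => k.
    rewrite !inE negb_forall => /existsP[i].
    by rewrite -ltnNge => ki; apply/bigcupP; exists i => //; rewrite inE.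
  rewrite big_distrr /=; elim/big_ind2: _ => [|x X y Y xX yY|i _].
  - by rewrite cards0.
  - by rewrite (leq_trans (leq_card_setU _ _)) // leq_add.
  exact: card_bad.
have := cardsC A; rewrite card_prod card_ffun !card_ord => AA.
have : (r * n ^ (m - 1) * n = r * n ^ m)%N.
  by rewrite -mulnA -expnSr subn1 prednK.
lia.
Qed.

(** * Sum-rank weight and maps factoring through a codeword *)

Section SumRankWeight.
Variables (F : finFieldType) (E : fieldExtType F) (m : nat) (e : 'rV[int]_m).
Local Notation sum_rank_space := {ffun latchar E e -> endE E}.

Lemma sum_rank_scaleE (a : E) (f : sum_rank_space) g (x : E) :
  ((a *: f) g : 'End(E)) x = a * (f g : 'End(E)) x.
Proof. by rewrite ffunE endE_scaleE. Qed.

Lemma sum_rank_sumE (J : Type) (s : seq J) (P : pred J)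
    (f : J -> sum_rank_space) g (x : E) :
  ((\sum_(j <- s | P j) f j) g : 'End(E)) x
  = \sum_(j <- s | P j) (f j g : 'End(E)) x.
Proof. by rewrite sum_ffunE sum_lfunE. Qed.

(* Evaluation at preimages of bases of the images of the components of [phi] is
   injective on the maps that factor through [phi].                           *)
Lemma free_factor_size (phi : sum_rank_space) (psi : seq sum_rank_space) :
  free psi ->
  (forall f, f \in psi -> forall g x,
     (phi g : 'End(E)) x = 0 -> (f g : 'End(E)) x = 0) ->
  (size psi <= sum_rank_weight phi)%N.
Proof.
move=> psi_free psi_ker.
pose T : predArgType := {g : latchar E e & 'I_(\dim (limg (phi g : 'End(E))))}.
pose pre (k : T) : E :=
  ((phi (tag k) : 'End(E))^-1)%VF
    (vbasis (limg (phi (tag k) : 'End(E))))`_(tagged k).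
pose ev_fun (f : sum_rank_space) : 'rV[E]_#|T| :=
  \row_k (f (tag (enum_val k)) : 'End(E)) (pre (enum_val k)).
have ev_lin : linear ev_fun.
  move=> a f g; apply/rowP => k.
  by rewrite !mxE ffunE add_lfunE ffunE endE_scaleE.
pose ev : 'Hom(sum_rank_space, 'rV[E]_#|T|) := linfun (HB.pack ev_fun
  (GRing.isLinear.Build E sum_rank_space 'rV[E]_#|T| *:%R ev_fun ev_lin)
  : {linear sum_rank_space -> 'rV[E]_#|T|}).
have span_ker f : f \in <<psi>>%VS -> forall g x,
    (phi g : 'End(E)) x = 0 -> (f g : 'End(E)) x = 0.
  move=> fs g x phix; rewrite (@coord_span _ _ _ (in_tuple psi) f fs).
  rewrite sum_rank_sumE big1 // => i _; rewrite sum_rank_scaleE.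
  by rewrite (psi_ker _ _ g x phix) ?mulr0 // mem_nth.
have ev0 : (<<psi>> :&: lker ev = 0)%VS.
  apply/eqP; rewrite -subv0; apply/subvP => f; rewrite memv_cap memv_ker memv0.
  case/andP=> /span_ker fker; rewrite lfunE /= => /eqP/rowP evf.
  apply/eqP/ffunP => g; apply/lfunP => x; rewrite ffunE zero_lfunE.
  pose b (j : 'I_(\dim (limg (phi g : 'End(E))))) := pre (Tagged _ j).
  have fb j : (f g : 'End(E)) (b j) = 0.
    by have := evf (enum_rank (Tagged _ j : T)); rewrite !mxE enum_rankK.
  have phib j : (phi g : 'End(E)) (b j) = (vbasis (limg (phi g : 'End(E))))`_j.
    by rewrite limg_lfunVK // vbasis_mem // mem_nth // size_tuple.
  have [k phix] : exists k : 'I_(\dim (limg (phi g : 'End(E)))) -> F,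
      (phi g : 'End(E)) x = (phi g : 'End(E)) (\sum_j k j *: b j).
    exists (fun j =>
      coord (vbasis (limg (phi g : 'End(E)))) j ((phi g : 'End(E)) x)).
    rewrite linear_sum /=.
    rewrite {1}(coord_vbasis (memv_img (phi g : 'End(E)) (memvf x))).
    by apply: eq_bigr => j _; rewrite linearZ /= phib.
  (* The difference of x and the combination of preimages is killed by [phi g], hence by [f g]. *)
  have := fker g (x - \sum_j k j *: b j).
  rewrite !linearB /= -phix subrr => /(_ erefl)/eqP.
  rewrite subr_eq0 linear_sum => /eqP ->.
  by apply: big1 => j _; rewrite linearZ /= fb scaler0.
rewrite -(eqnP psi_free) -(limg_dim_eq ev0).
apply: leq_trans (dimvS (subvf _)) _; rewrite dimvf /dim /= mul1n.
rewrite card_tagged sumnE big_map enumT.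
apply: eq_leq; rewrite /sum_rank_weight.
by apply: eq_bigr => g _; rewrite card_ord.
Qed.

End SumRankWeight.

(** * The footprint bound on the weight of a codeword *)

Section Footprint.
Variables (F : finFieldType) (E : fieldExtType F) (m : nat) (e : 'rV[int]_m).
Local Notation r := (\dim {:E}).
Local Notation n := #|F|.-1.
Local Notation sum_rank_space := {ffun latchar E e -> endE E}.
Variables (D : frame r e) (t : latchar E e -> 'rV[int]_m -> E).
Hypothesis t_ext : forall g : latchar E e, cocycle_extension g (t g).
Local Notation B := (dual D).

Definition monomial_map (u : 'rV[int]_m) : sum_rank_space :=
  [ffun g => t g u *: (frobz E (dotz e u) : endE E)].

Lemma monomial_mapE g u x : (monomial_map u g : 'End(E)) x = twist t g u x.
Proof. by rewrite ffunE endE_scaleE. Qed.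

Lemma combination_mapE (s : seq 'rV[int]_m) (a : 'rV[int]_m -> E) g x :
  ((\sum_(u <- s) a u *: monomial_map u) g : 'End(E)) x
  = \sum_(u <- s) a u * twist t g u x.
Proof.
rewrite sum_rank_sumE; apply: eq_bigr => u _.
by rewrite sum_rank_scaleE monomial_mapE.
Qed.

Lemma free_monomial_maps (s : seq 'rV[int]_m) :
  uniq s -> all (reduced D) s -> free (map monomial_map s).
Proof.
move=> us rs; apply: free_map => // a a0; apply: (twist_free t_ext us rs) => g x.
by rewrite -combination_mapE a0 ffunE zero_lfunE.
Qed.

Lemma reduced_point s (k : {ffun 'I_m -> 'I_n}) :
  reduced D (point D s (fun i => k i)).
Proof.
apply/reducedP => i; rewrite point_dual lez_nat ltz_nat /=.
rewrite (@leq_trans (r * (k i).+1)) ?leq_mul // mulnS ltn_add2r.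
by rewrite ltn_pmod // adim_gt0.
Qed.

(* The monomial order: additive, monotone in beta(u), injective on the box. *)
Definition weight (u : 'rV[int]_m) : int :=
  \sum_i (u *m B) 0 i * (r * n)%N%:Z ^+ i.

Lemma weightD u v : weight (u + v) = weight u + weight v.
Proof.
by rewrite /weight -big_split; apply: eq_bigr => i _; rewrite mulmxDl mxE mulrDl.
Qed.

Lemma weightB u v : weight (u - v) = weight u - weight v.
Proof. by apply/eqP; rewrite eq_sym subr_eq -weightD subrK. Qed.

(** On the box, the entries of u B are the digits of [weight u] in base r(q-1). *)
Lemma weight_inj u v :
  reduced D u -> reduced D v -> weight u = weight v -> u = v.
Proof.
move=> /reducedP ru /reducedP rv uv; apply: (@dual_inj _ _ _ D (adim_gt0 _)).
by apply/rowP => i; apply: (base_expansion_inj ru rv uv).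
Qed.

Lemma weight_le u v : (forall i, (u *m B) 0 i <= (v *m B) 0 i) ->
  weight u <= weight v.
Proof.
by move=> uv; apply: ler_sum => i _; rewrite ler_wpM2r // exprn_ge0.
Qed.

Lemma footprint_bound (c : nat) (s : seq 'rV[int]_m) (a : 'rV[int]_m -> E)
    (u1 : 'rV[int]_m) :
  (0 < m)%N -> all (reduced D) s -> uniq s ->
  (forall u, u \in s -> \sum_i (u *m B) 0 i <= (r * c)%N%:Z) ->
  u1 \in s -> a u1 != 0 ->
  (r * n ^ (m - 1) * (n - c) <=
     sum_rank_weight (\sum_(u <- s) a u *: monomial_map u)%R)%N.
Proof.
move=> m_gt0 red_s s_uniq s_deg u1s au1.
have r_gt0 : (0 < r)%N by apply: adim_gt0.
have n_gt0 : (0 < n)%N by rewrite -subn1 subn_gt0 (finNzRing_gt1 F).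
have [|u0] := @seq_argmax _ weight [seq u <- s | a u != 0].
  by rewrite -has_filter; apply/hasP; exists u1.
rewrite mem_filter => /andP[au0 u0s] u0_max.
have redP u : u \in s -> forall i, 0 <= (u *m B) 0 i < (r * n)%N%:Z.
  by move=> us; apply/reducedP; apply: (allP red_s).
have [|s0 [a0 u0E]] := @point_surj _ _ _ D r_gt0 u0.
  by move=> i; have /andP[] := redP u0 u0s i.
(* [A] indexes the points of the box that dominate the leading exponent u0 in every coordinate. *)
pose A := [set k : 'I_r * {ffun 'I_m -> 'I_n} |
  [forall i, frac_part D s0 i + r * a0 i <= frac_part D k.1 i + r * k.2 i]%N].
apply: (@leq_trans #|A|).
  apply: leq_trans (card_residue_vectors_above n (gen_coord D) s0 a0 r_gt0 m_gt0).
  rewrite mulnBr leq_sub2l // -mulnA mulnCA leq_mul2l; apply/orP; right.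
  rewrite -lez_nat (le_trans _ (s_deg u0 u0s)) // u0E -natz natr_sum.
  by apply: ler_sum => i _; rewrite point_dual natz.
pose phi := \sum_(u <- s) a u *: monomial_map u; rewrite -/phi.
pose pt (k : 'I_r * {ffun 'I_m -> 'I_n}) := point D k.1 (fun i => k.2 i).
(* If phi is the image of f, this is the image of X^(pt k - u0) f, with leading exponent [pt k]. *)
pose psi k : sum_rank_space :=
  [ffun g => ((monomial_map (pt k - u0) g : 'End(E)) \o (phi g : 'End(E)))%VF].
have psiE k g x : (psi k g : 'End(E)) x =
    \sum_(u <- s)
      frobz E (dotz e (pt k - u0)) (a u) * twist t g (pt k - u0 + u) x.
  rewrite ffunE comp_lfunE monomial_mapE combination_mapE /twist linear_sum /=.
  rewrite mulr_sumr; apply: eq_bigr => u _; rewrite frobzM mulrCA.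
  by congr (_ * _); symmetry; apply: (twistD t_ext).
rewrite cardE -(size_map psi); apply: free_factor_size; last first.
  move=> _ /mapP[k _ ->] g x phix.
  by rewrite ffunE comp_lfunE phix linear0.
apply: free_map => [|c' rel k]; first exact: enum_uniq.
rewrite mem_enum => kA; apply/eqP; apply: contraT => ck.
(* A nontrivial relation has a leading index k0; it is refuted by collecting the terms whose
   exponent reduces to that of [pt k0], among which only (k0, u0) has a nonzero coefficient. *)
have [|k0] := @seq_argmax _ (weight \o pt) [seq k <- enum A | c' k != 0].
  by rewrite -has_filter; apply/hasP; exists k; rewrite ?mem_enum.
rewrite mem_filter mem_enum => /andP[ck0 k0A] k0_max.
pose J := [seq (k, u) | k <- enum A, u <- s].
have J_uniq : uniq J by apply: allpairs_uniq; rewrite ?enum_uniq //; case=> ? ? [].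
pose cJ (j : ('I_r * {ffun 'I_m -> 'I_n}) * 'rV[int]_m) :=
  c' j.1 * frobz E (dotz e (pt j.1 - u0)) (a j.2).
pose pJ (j : ('I_r * {ffun 'I_m -> 'I_n}) * 'rV[int]_m) := pt j.1 - u0 + j.2.
have relJ g x : \sum_(j <- J) cJ j * twist t g (pJ j) x = 0.
  have := congr1 (fun f : sum_rank_space => (f g : 'End(E)) x) rel.
  rewrite sum_rank_sumE ffunE zero_lfunE => rel0; rewrite -[RHS]rel0 big_allpairs.
  apply: eq_bigr => k' _; rewrite sum_rank_scaleE psiE mulr_sumr.
  by apply: eq_bigr => u _; rewrite -mulrA.
have := twist_relation D t_ext relJ (reduction D (pt k0)).
have j0J : (k0, u0) \in J by apply/allpairsP; exists (k0, u0); rewrite mem_enum.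
rewrite big_mkcond (bigD1_seq (k0, u0)) //= {1}/pJ /= subrK eqxx.
rewrite big1_seq => [|[k' u] /andP[ju /allpairsP[[k'' u''] [/=]]]].
  rewrite addr0 /cJ /= => /eqP; rewrite mulf_eq0 (negPf ck0) /=.
  by rewrite (negPf (frobz_neq0 _ au0)).
rewrite mem_enum => k'A us [kk uu]; rewrite -{k''}kk -{u''}uu in k'A us.
case: eqP => // redE; rewrite /cJ /=.
have [->|ck'] := eqVneq (c' k') 0; first by rewrite mul0r.
have [->|au] := eqVneq (a u) 0; first by rewrite linear0 mulr0.
case/negP: ju; suff [-> ->] : k' = k0 /\ u = u0 by [].
have wu : weight u <= weight u0 by apply: u0_max; rewrite mem_filter au.
have wk : weight (pt k') <= weight (pt k0).
  by apply: k0_max; rewrite mem_filter ck' mem_enum.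
(* The coordinates of [pJ (k', u)] are nonnegative because [pt k'] dominates u0; their residues
   modulo r(q-1) are the coordinates of [pt k0], which are therefore no larger. *)
have pk i : (pt k0 *m B) 0 i <= (pJ (k', u) *m B) 0 i.
  have := congr1 (fun v => (v *m B) 0 i) redE; rewrite !reduction_dual.
  have /reducedP/(_ i) red_k0 := reduced_point k0.1 k0.2.
  rewrite [RHS]modz_small //.
  move=> <-.
  have : 0 <= (pJ (k', u) *m B) 0 i.
    rewrite /pJ /= mulmxDl mxE addr_ge0 //; last by have /andP[] := redP u us i.
    rewrite mulmxBl mxE [X in _ + X]mxE subr_ge0 u0E /pt !point_dual.
    by move: k'A; rewrite inE => /forallP/(_ i).
  move: ((pJ _ *m B) 0 i) => y y0; rewrite {2}(divz_eq y (r * n)%N) lerDr.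
  by rewrite mulr_ge0 // divz_ge0 // ltz_nat muln_gt0 r_gt0.
have wle := weight_le pk.
have wJ : weight (pJ (k', u)) = weight (pt k') - weight u0 + weight u.
  by rewrite /pJ weightD weightB.
(* Maximality of k0 and u0 bounds the weight of [pJ (k', u)] above by that of [pt k0], and [wle]
   bounds it below, so both maxima are attained. *)
have [wkk wuu] : weight (pt k') = weight (pt k0) /\ weight u = weight u0.
  move: wk wu wle; rewrite wJ.
  move: (weight _) (weight _) (weight _) (weight _); clear=> x y z v; lia.
have kk : k' = k0.
  have := weight_inj (reduced_point k'.1 k'.2) (reduced_point k0.1 k0.2) wkk.
  move/(point_inj r_gt0 (ltn_ord _) (ltn_ord _)) => [s12 a12].
  rewrite [k']surjective_pairing [k0]surjective_pairing; congr (_, _).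
    exact: val_inj.
  by apply/ffunP => i; apply: val_inj; apply: a12.
by split=> //; apply: weight_inj; [exact: (allP red_s)|exact: (allP red_s)|].
Qed.

End Footprint.

(** * Binomial coefficients as polynomials *)

Lemma natr_ffact (K : pzRingType) (n m : nat) :
  (n ^_ m)%:R = \prod_(i < m) (n%:R - i%:R) :> K.
Proof.
elim: m => [|m IHm]; first by rewrite big_ord0.
rewrite ffactnSr natrM IHm big_ord_recr /=.
have [mn|nm] := leqP m n; first by rewrite natrB.
by rewrite -IHm ffact_small // !mul0r.
Qed.

(** The witness is the falling factorial of X + k divided by m!; it vanishes, as it must, when t + k
    < m. *)
Lemma binomial_polynomial (m k : nat) :
  exists P : {poly rat}, forall t : nat, P.[t%:R] = 'C(t + k, m)%:R.
Proof.
exists ((m`!%:R)^-1 *: \prod_(i < m) ('X + (k%:R - i%:R)%:P)) => t.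
have m0 : m`!%:R != 0 :> rat by rewrite pnatr_eq0 -lt0n fact_gt0.
apply: (mulfI m0); rewrite hornerZ mulrA mulfV // mul1r -natrM mulnC bin_ffact.
rewrite natr_ffact horner_prod; apply: eq_bigr => i _.
by rewrite !hornerE natrD.
Qed.

(** * Lattice points of the dilated simplex and its Ehrhart polynomial *)

Section SimplexPoints.
Variables (R : realType) (m r : nat) (e : 'rV[int]_m) (D : frame r e).
Hypothesis r_gt0 : (0 < r)%N.
Local Notation B := (dual D).
Variable w : 'I_m -> 'rV[int]_m.
Hypothesis basisE : basis D = \matrix_i w i.

(** The lambda_i are the coordinates of u in the basis, that is, the entries of u B divided by r. *)
Lemma simplex_pointsP (c : nat) u :
  lattice_points (simplex w (c%:R : R)) u <->
  (forall i, 0 <= (u *m B) 0 i) /\ \sum_i (u *m B) 0 i <= (r * c)%N%:Z.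
Proof.
have rR : 0 < r%:R :> R by rewrite ltr0n.
pose toR (k : nat) := map_mx (intr : int -> R) : 'rV[int]_k -> _.
have lamE (lam : 'I_m -> R) : \sum_i lam i *: map_mx intr (w i) =
    \row_i lam i *m map_mx intr (basis D) :> 'rV[R]_m.
  rewrite mulmx_sum_row; apply: eq_bigr => i _.
  by rewrite mxE -map_row basisE rowK.
have uBE : map_mx intr (u *m B) = map_mx intr u *m map_mx intr B :> 'rV[R]_m.
  exact: map_mxM.
split=> [[lam [lam_ge0 lam_sum uE]]|[u_ge0 u_sum]].
  have uB i : ((u *m B) 0 i)%:~R = r%:R * lam i :> R.
    have := congr1 (fun x : 'rV[R]_m => x 0 i) uBE.
    rewrite mxE => ->; rewrite uE lamE -mulmxA -map_mxM basisK map_scalar_mx.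
    by rewrite mul_mx_scalar !mxE.
  split=> [i|]; first by rewrite -(ler0z R) uB mulr_ge0 // ltW.
  rewrite -(ler_int R) rmorph_sum /= (eq_bigr _ (fun i _ => uB i)) -mulr_sumr.
  by rewrite PoszM rmorphM /= ler_pM2l.
exists (fun i => ((u *m B) 0 i)%:~R / r%:R); split=> [i||].
- by rewrite divr_ge0 ?ler0z // ltW.
- rewrite -mulr_suml ler_pdivrMr // -rmorph_sum /= -[_ * _]natrM mulnC.
  by rewrite [leRHS]pmulrn ler_int.
rewrite lamE (_ : \row_i _ = r%:R^-1 *: map_mx intr (u *m B)); last first.
  by apply/rowP => i; rewrite !mxE mulrC.
rewrite -scalemxAl -map_mxM -mulmxA dualK mul_mx_scalar.
by apply/rowP => i; rewrite !mxE rmorphM /= mulKf // gt_eqF.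
Qed.

(** The sum of the fractional parts of class s, rounded up: adding r - 1 before the division gives
    the ceiling. *)
Definition frac_ceil (s : nat) : nat :=
  ((\sum_(i < m) frac_part D s i + r.-1) %/ r)%N.

Lemma frac_ceil_le s : (frac_ceil s <= m)%N.
Proof.
have f_le : (\sum_(i < m) frac_part D s i <= m * r.-1)%N.
  rewrite -[X in (_ <= X * _)%N](card_ord m) -sum_nat_const.
  apply: leq_sum => i _.
  by rewrite -ltnS prednK // ltn_pmod.
rewrite -ltnS ltn_divLR //; move: (\sum_(i < m) _)%N f_le => f.
by case: (r) r_gt0 => // r' _ /=; nia.
Qed.

Lemma frac_ceilP s k c :
  (\sum_(i < m) frac_part D s i + r * k <= r * c)%N = (frac_ceil s + k <= c)%N.
Proof.
rewrite /frac_ceil; move: (\sum_(i < m) _)%N => f.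
rewrite [(_ + k)%N]addnC -divnMDl // -[RHS]ltnS ltn_divLR //.
by case: (r) r_gt0 => // r' _ /=; apply/idP/idP; nia.
Qed.

(** The test on [frac_ceil s] excludes the classes where truncated subtraction would leave a
    spurious zero tuple. *)
Definition simplex_points (c : nat) : seq 'rV[int]_m :=
  [seq point D s (fun i => tnth a i) | s : 'I_r <- enum 'I_r,
    a : m.-tuple 'I_(c - frac_ceil s).+1 <- if (frac_ceil s <= c)%N then
           enum [set a : m.-tuple 'I_(c - frac_ceil s).+1 |
                  (\sum_(i <- a) i <= c - frac_ceil s)%N]
         else [::]].

Lemma mem_simplex_points (c : nat) u :
  u \in simplex_points c <->
  (forall i, 0 <= (u *m B) 0 i) /\ \sum_i (u *m B) 0 i <= (r * c)%N%:Z.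
Proof.
have sumE s a : \sum_i (point D s a *m B) 0 i =
    (\sum_(i < m) frac_part D s i + r * \sum_i a i)%N.
  rewrite big_distrr -big_split /= -natz natr_sum; apply: eq_bigr => i _.
  by rewrite point_dual natz.
split=> [/allpairsPdep[s [a [_ + ->]]]|[u_ge0 u_le]].
  case: leqP => // sc; rewrite mem_enum inE big_tuple => a_le.
  split=> [i|]; first by rewrite point_dual.
  by rewrite sumE lez_nat frac_ceilP -leq_subRL.
have [s [a uE]] := point_surj r_gt0 u_ge0.
move: u_le; rewrite uE sumE lez_nat frac_ceilP => sa.
have sc : (frac_ceil s <= c)%N := leq_trans (leq_addr _ _) sa.
have a_le : (\sum_i a i <= c - frac_ceil s)%N by rewrite leq_subRL.
have ai i : (a i < (c - frac_ceil s).+1)%N.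
  by rewrite ltnS (leq_trans _ a_le) // (bigD1 i) //= leq_addr.
apply/allpairsPdep; exists s, [tuple Ordinal (ai i) | i < m]; split.
- by rewrite mem_enum.
- rewrite sc mem_enum inE big_tuple.
  by under eq_bigr do rewrite tnth_mktuple.
by congr (_ + _ *m _); apply/rowP => i; rewrite !mxE tnth_mktuple.
Qed.

Lemma simplex_points_uniq c : uniq (simplex_points c).
Proof.
apply: allpairs_uniq_dep; first exact: enum_uniq.
  by move=> s _; case: ifP => // _; apply: enum_uniq.
move=> [s a] [s' a'] _ _ /= /(point_inj r_gt0 (ltn_ord _) (ltn_ord _))[/val_inj ss'].
rewrite -{s'}ss' in a' * => aa'; congr existT.
by apply: eq_from_tnth => i; apply: val_inj; apply: aa'.
Qed.

(** There are binomial(N + m, m) tuples of m naturals with sum at most N. If c < [frac_ceil s], the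
    class is empty and the binomial vanishes too, its upper entry being below m; so one formula
    serves all c. *)
Lemma size_simplex_points c :
  size (simplex_points c) = (\sum_(s < r) 'C(c + (m - frac_ceil s), m))%N.
Proof.
rewrite size_allpairs_dep sumnE big_map big_enum /=; apply: eq_bigr => s _.
have sm := frac_ceil_le s; case: leqP => [sc|cs].
  by rewrite -cardE card_partial_ord_partitions; congr 'C(_, _); lia.
by rewrite bin_small //=; lia.
Qed.

Lemma lattice_points_simplex c :
  lattice_points (simplex w (c%:R : R)) = [set` simplex_points c]%classic.
Proof.
by apply/seteqP; split=> u /=; rewrite mem_simplex_points simplex_pointsP.
Qed.

Lemma lattice_card_simplex c :
  lattice_card (simplex w (c%:R : R)) = size (simplex_points c).
Proof.
rewrite /lattice_card lattice_points_simplex.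
have -> : ([set` simplex_points c] = [set` [fset u in simplex_points c]%fset])%classic.
  by apply/seteqP; split=> u /=; rewrite inE.
by rewrite set_fsetK card_fseq undup_id // simplex_points_uniq.
Qed.

(** Once some polynomial has these values, [xget] selects such a polynomial; the sum over the
    classes of the binomial counts is one. *)
Lemma ehrhart_simplex (c : nat) :
  (ehrhart R w).[c%:R] = (lattice_card (simplex w (c%:R : R)))%:R.
Proof.
rewrite /ehrhart; set S := (X in xget 0 X).
suff /(xgetPex 0) : exists P, S P by apply.
have [P PE] := choice (fun s => binomial_polynomial m (m - frac_ceil s)).
exists (\sum_(s < r) P s) => t.
rewrite lattice_card_simplex size_simplex_points natr_sum horner_sum.
by apply: eq_bigr.
Qed.

End SimplexPoints.

(** * The code as a span, its dimension and its minimum distance *)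

Section Code.
Variables (R : realType) (F : finFieldType) (E : fieldExtType F) (m : nat).
Variables (e : 'rV[int]_m) (t : latchar E e -> 'rV[int]_m -> E).

Lemma eps_combination (f : ore E e) (s : seq 'rV[int]_m) : uniq s ->
  {subset msupp f <= s} ->
  eps t f = \sum_(u <- s) f@_u *: monomial_map t u.
Proof.
move=> s_uniq fs; apply/ffunP => g; rewrite ffunE sum_ffunE /eps_at.
rewrite [RHS](bigID (fun u => u \in msupp f)) /=.
rewrite [X in _ + X]big1 => [|u uf]; last first.
  by rewrite mcoeff_outdom // scale0r ffunE.
rewrite addr0; apply/esym; rewrite -big_filter (perm_big (msupp f)) /=.
  by apply: eq_bigr => u _; rewrite !ffunE scalerA.
rewrite uniq_perm ?filter_uniq ?fset_uniq // => u.
by rewrite mem_filter; apply: andb_idr; apply: fs.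
Qed.

Lemma LRM_span (C : set 'rV[R]_m) (s : seq 'rV[int]_m) : uniq s ->
  lattice_points C = [set` s]%classic ->
  LRM t C = [set` <<map (monomial_map t) s>>%VS]%classic.
Proof.
move=> s_uniq Cs; apply/seteqP; split=> [_ [f fC <-]|phi /= phi_s] /=.
  rewrite (eps_combination s_uniq) => [|u /fC]; last by rewrite Cs inE.
  rewrite big_seq; apply: rpred_sum => u us.
  by apply/rpredZ/memv_span/map_f.
have [a ->] := mem_span_map s_uniq phi_s.
pose f : ore E e := \sum_(u <- s) << a u *g u >>.
have fE u : f@_u = \sum_(v <- s) a v *+ (v == u).
  by rewrite /f raddf_sum; apply: eq_bigr => v _; rewrite /= mcoeffU.
have f_s : {subset msupp f <= s}.
  move=> u; rewrite -mcoeff_neq0 fE; apply: contraR => us.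
  rewrite big1_seq // => v /andP[_ vs]; case: eqP => // vu.
  by rewrite -vu vs in us.
exists f; first by move=> u /f_s us; rewrite Cs inE.
rewrite (eps_combination s_uniq f_s); apply: eq_big_seq => u us.
rewrite fE (bigD1_seq u) //= eqxx big1 ?addr0 // => v /negPf ->.
by rewrite mulr0n.
Qed.

End Code.

Theorem theorem3p9 (R : realType) (F : finFieldType) (E : fieldExtType F)
    (m : nat) (m_gt0 : (0 < m)%N) (e : 'rV[int]_m)
    (gcd_e : gcdn (\big[gcdn/0%N]_(i < m) absz (e 0 i)) (\dim {:E}) = 1%N)
    (w : 'I_m -> 'rV[int]_m) (w_basis : lattice_basis (\dim {:E}) e w)
    (t : latchar E e -> 'rV[int]_m -> E)
    (t_ext : forall g : latchar E e, cocycle_extension g (t g))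
    (c : nat) (c_le : (c <= #|F| - 2)%N) :
  exists k d : nat,
    [/\ has_dimension (LRM t (simplex w (c%:R : R))) k,
        is_min_distance (LRM t (simplex w (c%:R : R))) d,
        k = lattice_card (simplex w (c%:R : R)),
        k%:R = (ehrhart R w).[c%:R] &
        (\dim {:E} * (#|F| - 1) ^ (m - 1) * (#|F| - 1 - c) <= d)%N].
Proof.
have r_gt0 : (0 < \dim {:E})%N by apply: adim_gt0.
have q_gt1 : (1 < #|F|)%N := finNzRing_gt1 F.
have [D basisE] := frame_exists r_gt0 gcd_e w_basis.
pose s := simplex_points D c.
have s_uniq : uniq s := simplex_points_uniq D r_gt0 c.
have s_mem u : u \in s <-> _ := mem_simplex_points D r_gt0 c u.
(* Each coordinate is at most the sum of all, hence at most r c, and c < q - 1 because q > 1. *)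
have s_red : all (reduced D) s.
  apply/allP => u /s_mem[u_ge0 u_le]; apply/reducedP => i; rewrite u_ge0 /=.
  apply: le_lt_trans (_ : (\dim {:E} * c)%N%:Z < _); last first.
    rewrite ltz_nat ltn_pmul2l //; move: c_le q_gt1.
    by case: #|F| => [|[]]; lia.
  apply: le_trans u_le; rewrite (bigD1 i) //= lerDl.
  exact: sumr_ge0.
have s_free := free_monomial_maps t_ext s_uniq s_red.
have LRM_E := LRM_span t s_uniq (lattice_points_simplex R r_gt0 basisE c).
(* The minimum distance is the least d with this property; the exponent 0, a point of the simplex,
   shows that some d has it. *)
pose is_wt d := `[< exists phi, [/\ phi \in <<map (monomial_map t) s>>%VS,
   phi != 0 & sum_rank_weight phi = d] >].
have wt_ex : exists d, is_wt d.
  exists (sum_rank_weight (monomial_map t 0)); apply/asboolP.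
  exists (monomial_map t 0).
  have s0 : monomial_map t 0 \in map (monomial_map t) s.
    apply/map_f/s_mem; rewrite mul0mx big1 => [|i _]; last by rewrite mxE.
    by split=> // i; rewrite mxE.
  by split=> //; [apply: memv_span | apply: (free_not0 s_free)].
have [d /asboolP[phi0 [phi0_s phi0_neq0 phi0_wt]] d_min] := ex_minnP wt_ex.
exists (size s), d; split.
- exists <<map (monomial_map t) s>>%VS => //.
  by rewrite (eqnP s_free) size_map.
- rewrite LRM_E; split; first by exists phi0.
  move=> phi phi_s phi_neq0; apply: d_min; apply/asboolP.
  by exists phi.
- by rewrite (lattice_card_simplex R r_gt0 basisE).
- by rewrite (ehrhart_simplex R r_gt0 basisE) (lattice_card_simplex R r_gt0 basisE).
have [a phi0E] := mem_span_map s_uniq phi0_s.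
have [u us au] : exists2 u, u \in s & a u != 0.
  apply: contrapT => a0; case/eqP: phi0_neq0; rewrite phi0E big1_seq //.
  move=> u /andP[_ us]; have [->|au] := eqVneq (a u) 0; first by rewrite scale0r.
  by case: a0; exists u.
rewrite -phi0_wt phi0E subn1.
by apply: (footprint_bound t_ext m_gt0 s_red s_uniq _ us au) => v /s_mem[].
Qed.
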